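(* Let $\mathcal H=U(so(1,3))$ be the classical Lorentz algebra acting on functions $\mathcal M$ on Minkowski space and on differential operators on $\mathcal M$, and let $\Phi$ be a twist of $\mathcal H$. Put $$\tilde g^{\rho\xi}=g^{\mu\nu}(\Phi^{-1})^{\rho\xi}_{\mu\nu}.$$ Then, as differential operators, $$\tilde g^{\mu\nu}\,\partial_\mu*\partial_\nu=g^{\mu\nu}\,\partial_\mu\cdot\partial_\nu ,$$ and if $f\in\mathcal M$ satisfies the classical Klein-Gordon-Fock equation $(g^{\mu\nu}\partial_\mu\cdot\partial_\nu+m^2)f=0$, then $f$, regarded as an element of the twisted module $\tilde{\mathcal M}$, satisfies the quantum Klein-Gordon-Fock equation $$(\tilde g^{\mu\nu}\,\partial_\mu*\partial_\nu+m^2)*f=0 .$$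
   Context: $z^\mu$ ($\mu=1,\dots,4$) are linear coordinates on the classical (complexified) Minkowski space, $g^{\mu\nu}$ is the Lorentz-invariant metric, $\partial_\mu=\partial/\partial z^\mu$, and $m$ is a constant. Functions are formal power series in the $z^\mu$. $\mathcal H$ acts linearly on the span of the $z^\mu$, extended to $\mathcal M$ so that $h(a\cdot b)=h^{(1)}a\cdot h^{(2)}b$ where $\Delta(h)=h^{(1)}\otimes h^{(2)}$. The algebra $\mathrm{Diff}(\mathcal M)$ of differential operators carries the induced (adjoint) action, under which the span of the $\partial_\mu$ is the dual representation, and $h(A\cdot f)=h^{(1)}A\cdot h^{(2)}f$. The operator $g^{\mu\nu}\partial_\mu\cdot\partial_\nu$ is Lorentz invariant. A twist is an invertible element $\Phi=\Phi_1\otimes\Phi_2$ of $\mathcal H\otimes\mathcal H$ (summation suppressed; to have nontrivial twists one allows formal power series in a deformation parameter, with $\mathcal M$ and $\mathrm{Diff}(\mathcal M)$ extended accordingly) such that $$(\Delta\otimes \mathrm{id})(\Phi)\,\Phi_{12}=(\mathrm{id}\otimes\Delta)(\Phi)\,\Phi_{23},\qquad (\varepsilon\otimes \mathrm{id})(\Phi)=1=(\mathrm{id}\otimes\varepsilon)(\Phi).$$ The twisted operations are $A*B=(\Phi_1A)\cdot(\Phi_2B)$ for differential operators $A,B$ and $A*f=(\Phi_1A)\cdot(\Phi_2f)$ for $f\in\mathcal M$; $\tilde{\mathcal M}$ is $\mathcal M$ with the twisted structures. The matrix $(\Phi^{-1})^{\rho\xi}_{\mu\nu}$ is that of the action of $\Phi^{-1}$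 on pairs of partial derivatives: $\Phi^{-1}(\partial_\mu\otimes\partial_\nu)=(\Phi^{-1})^{\rho\xi}_{\mu\nu}\,\partial_\rho\otimes\partial_\xi$. Repeated indices are summed. *)

(* Defs.v *)
From HB Require Import structures.
From mathcomp Require Import all_boot all_order all_algebra.
From mathcomp Require Import boolp classical_sets functions reals complex.
From mathcomp Require Import mpoly.
From mathcomp Require Import ring.

Set Implicit Arguments.
Unset Strict Implicit.
Unset Printing Implicit Defensive.

Import Order.TTheory GRing.Theory Num.Theory.

Local Open Scope ring_scope.
Local Open Scope quotient_scope.

Reserved Notation "a ⊗ b" (at level 40, left associativity).

Section SeparatingFunctional.
Local Open Scope classical_set_scope.
Variables (F : fieldType) (V : lmodType F).

(* Only needed to see that the tensor product of two nonzero algebras is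
   nonzero, as algType requires. *)
Lemma separating_functional (v : V) : v != 0 ->
  exists l : V -> F^o, linear l /\ l v = 1.
Proof.
move=> v0.
pose P (S : set V) := ~ S v /\ forall c x y, S x -> S y -> S (c *: x + y).
have [S [[Sv Slin] Smax]] : exists S, P S /\ forall B, S `<` B -> ~ P B.
  apply: Zorn_bigcup => G GP Gtot; split.
    by case=> B GB Bv; case: (GP B GB) => /(_ Bv).
  move=> c x y [B GB Bx] [B' GB' By].
  have [BB'|B'B] := Gtot _ _ GB GB'.
    by exists B' => //; apply: (GP _ GB').2 => //; apply: BB'.
  by exists B => //; apply: (GP _ GB).2 => //; apply: B'B.
have S0 : S 0.
  apply: contrapT => nS0.
  have [[x Sx]|S_0] := pselect (exists x, S x).
    by apply: nS0; have := Slin (-1) x x Sx Sx; rewrite scaleN1r addNr.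
  apply: (Smax [set 0]).
    split; last by move=> /(_ 0 erefl); exact: nS0.
    by move=> x Sx; case: S_0; exists x.
  split; first by move=> /= v_0; rewrite v_0 eqxx in v0.
  by move=> c x y /= -> ->; rewrite scaler0 addr0.
have SZ c x : S x -> S (c *: x) by move=> Sx; rewrite -[_ *: _]addr0; apply: Slin.
have SD x y : S x -> S y -> S (x + y).
  by move=> Sx Sy; rewrite -[x]scale1r; apply: Slin.
have dec x : exists c, S (x - c *: v).
  have [Sx|Sx] := pselect (S x); first by exists 0; rewrite scale0r subr0.
  pose B := [set y | exists d, S (y - d *: x)].
  have [c Sc] : B v.
    apply: contrapT => Bv; apply: (Smax B).
      split; first by move=> y Sy; exists 0; rewrite scale0r subr0.
      by move=> /(_ x) BS; apply/Sx/BS; exists 1; rewrite scale1r subrr.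
    split=> // c y z [d Sd] [e Se]; exists (c * d + e).
    suff -> : c *: y + z - (c * d + e) *: x = c *: (y - d *: x) + (z - e *: x).
      exact: Slin.
    by rewrite scalerBr scalerDl scalerA opprD addrACA.
  have c0 : c != 0 by apply: contra_notN Sv => /eqP c0; rewrite c0 scale0r subr0 in Sc.
  exists c^-1; have := SZ (- c^-1) _ Sc.
  by rewrite scalerBr scalerA mulNr mulVf // scaleN1r opprK addrC scaleNr.
have uniq x c d : S (x - c *: v) -> S (x - d *: v) -> c = d.
  move=> Sc Sd; apply/eqP; rewrite -subr_eq0; apply: contra_notT Sv => cd.
  have := SZ (c - d)^-1 _ (Slin (-1) _ _ Sc Sd).
  rewrite scaleN1r opprB addrA subrK -scalerBl scalerA mulVf // scale1r.
  by [].
have [l Hl] := choice dec; exists l; split; last first.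
  by apply: (uniq v) => //; rewrite scale1r subrr.
move=> c x y; rewrite [RHS](_ : _ = c * l x + l y) //.
apply: (uniq (c *: x + y)) => //.
suff -> : c *: x + y - (c * l x + l y) *: v = c *: (x - l x *: v) + (y - l y *: v).
  exact: Slin.
by rewrite scalerBr scalerDl scalerA opprD addrACA.
Qed.
End SeparatingFunctional.

Section Tensor.
Variables (F : fieldType) (A B : lmodType F).

(* A (x) B: finite formal sums of pairs (a, b), two sums being identified when
   every bilinear map to an F-vector space takes the same total value on both.
   This is the usual quotient, since the usual tensor product is itself the
   target of a bilinear map through which all the others factor. *)
Definition formal_tensor := seq (A * B).
HB.instance Definition _ := gen_eqMixin formal_tensor.
HB.instance Definition _ := gen_choiceMixin formal_tensor.

Definition tens_eval (W : nmodType) (b : A -> B -> W) (s : formal_tensor) : W :=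
  \sum_(p <- s) b p.1 p.2.

Definition tens_eqv (s t : formal_tensor) : bool :=
  `[< forall (W : lmodType F) (b : A -> B -> W),
        bilinear_for *:%R *:%R b -> tens_eval b s = tens_eval b t >].

Lemma tens_eqv_equiv : equiv_class_of tens_eqv.
Proof.
split.
- by move=> s; apply/asboolP.
- move=> s t; apply/idP/idP => /asboolP E; apply/asboolP => W b bP;
  by rewrite (E W b bP).
- move=> t s u /asboolP E /asboolP E'; apply/asboolP => W b bP.
  by rewrite (E W b bP) (E' W b bP).
Qed.
Canonical tens_eqv_rel := EquivRelPack tens_eqv_equiv.

Definition tensor : Type := {eq_quot tens_eqv_rel}.
HB.instance Definition _ := Choice.on tensor.
HB.instance Definition _ := EqQuotient.on tensor.

Definition pure_tensor (a : A) (b : B) : tensor := \pi_tensor [:: (a, b)].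

(* The linear map A (x) B -> W induced by a bilinear b; the value on an arbitrary
   b depends on the chosen representative and is never used. *)
Definition tens_lift (W : nmodType) (b : A -> B -> W) (x : tensor) : W :=
  tens_eval b (repr x).

Lemma tens_lift_pi (W : lmodType F) (b : A -> B -> W) s :
  bilinear_for *:%R *:%R b -> tens_lift b (\pi_tensor s) = tens_eval b s.
Proof.
move=> bP; rewrite /tens_lift.
have /eqquotP/asboolP : repr (\pi_tensor s) = s %[mod tensor] by rewrite reprK.
exact.
Qed.

Lemma tens_ext x y :
  (forall (W : lmodType F) (b : A -> B -> W),
     bilinear_for *:%R *:%R b -> tens_lift b x = tens_lift b y) -> x = y.
Proof.
move=> E; rewrite -[x]reprK -[y]reprK; apply/eqquotP/asboolP => W b bP.
exact: E.
Qed.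

Definition tens_add (x y : tensor) := \pi_tensor (repr x ++ repr y).
Definition tens_scale c (x : tensor) :=
  \pi_tensor [seq (c *: p.1, p.2) | p <- repr x].
Definition tens_opp (x : tensor) := tens_scale (-1) x.
Definition tens_zero := \pi_tensor [::].

Section Eval.
Variables (W : lmodType F) (b : A -> B -> W) (bP : bilinear_for *:%R *:%R b).
Lemma bilin0l y : b 0 y = 0.
Proof. by have := bP.1 y (-1) 0 0; rewrite /= scaler0 addr0 scaleN1r addNr. Qed.
Lemma bilin0r x : b x 0 = 0.
Proof. by have := bP.2 x (-1) 0 0; rewrite /= scaler0 addr0 scaleN1r addNr. Qed.
Lemma bilinZl c x y : b (c *: x) y = c *: b x y.
Proof. by have := bP.1 y c x 0; rewrite /= bilin0l !addr0. Qed.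
Lemma bilinZr c x y : b x (c *: y) = c *: b x y.
Proof. by have := bP.2 x c y 0; rewrite /= bilin0r !addr0. Qed.
Lemma bilinDl x x' y : b (x + x') y = b x y + b x' y.
Proof. by have := bP.1 y 1 x x'; rewrite /= !scale1r. Qed.
Lemma bilinDr x y y' : b x (y + y') = b x y + b x y'.
Proof. by have := bP.2 x 1 y y'; rewrite /= !scale1r. Qed.

Lemma tens_lift_add x y :
  tens_lift b (tens_add x y) = tens_lift b x + tens_lift b y.
Proof. by rewrite tens_lift_pi // /tens_eval big_cat. Qed.
Lemma tens_lift_scale c x : tens_lift b (tens_scale c x) = c *: tens_lift b x.
Proof.
rewrite tens_lift_pi // /tens_eval big_map scaler_sumr; apply: eq_bigr => p _.
exact: bilinZl.
Qed.
Lemma tens_lift_zero : tens_lift b tens_zero = 0.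
Proof. by rewrite tens_lift_pi // /tens_eval big_nil. Qed.
Lemma tens_lift_pure x y : tens_lift b (pure_tensor x y) = b x y.
Proof. by rewrite tens_lift_pi // /tens_eval big_seq1. Qed.
End Eval.

Definition tens_liftE :=
  (tens_lift_add, tens_lift_scale, tens_lift_zero, tens_lift_pure).

Fact tens_addA : associative tens_add.
Proof. by move=> x y z; apply: tens_ext => W b bP; rewrite !tens_liftE // addrA. Qed.
Fact tens_addC : commutative tens_add.
Proof. by move=> x y; apply: tens_ext => W b bP; rewrite !tens_liftE // addrC. Qed.
Fact tens_add0 : left_id tens_zero tens_add.
Proof. by move=> x; apply: tens_ext => W b bP; rewrite !tens_liftE // add0r. Qed.
Fact tens_addN : left_inverse tens_zero tens_opp tens_add.
Proof.
move=> x; apply: tens_ext => W b bP.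
by rewrite !tens_liftE // scaleN1r addNr.
Qed.
HB.instance Definition _ :=
  GRing.isZmodule.Build tensor tens_addA tens_addC tens_add0 tens_addN.

Fact tens_scaleA c d x : tens_scale c (tens_scale d x) = tens_scale (c * d) x.
Proof. by apply: tens_ext => W b bP; rewrite !tens_liftE // scalerA. Qed.
Fact tens_scale1 : left_id 1 tens_scale.
Proof. by move=> x; apply: tens_ext => W b bP; rewrite !tens_liftE // scale1r. Qed.
Fact tens_scaleDr : right_distributive tens_scale +%R.
Proof.
by move=> c x y; apply: tens_ext => W b bP; rewrite !tens_liftE // scalerDr.
Qed.
Fact tens_scaleDl x : {morph tens_scale^~ x : c d / c + d}.
Proof.
by move=> c d; apply: tens_ext => W b bP; rewrite !tens_liftE // scalerDl.
Qed.
HB.instance Definition _ :=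
  GRing.Zmodule_isLmodule.Build F tensor
    tens_scaleA tens_scale1 tens_scaleDr tens_scaleDl.

Lemma tens_lift_linear (W : lmodType F) (b : A -> B -> W) :
  bilinear_for *:%R *:%R b -> linear (tens_lift b).
Proof.
by move=> bP c x y; rewrite tens_lift_add // tens_lift_scale.
Qed.

Lemma pure_tensor_bilinear : bilinear_for *:%R *:%R pure_tensor.
Proof.
split=> [y c x x'|x c y y']; apply: tens_ext => W b bP.
  by rewrite tens_lift_linear // !tens_liftE //= bP.1.
by rewrite tens_lift_linear // !tens_liftE //= bP.2.
Qed.

Lemma tensorE x : exists s : seq (A * B), x = \sum_(p <- s) pure_tensor p.1 p.2.
Proof.
exists (repr x); apply: tens_ext => W b bP; rewrite /tens_lift {1}/tens_eval.
rewrite -/(tens_lift b _).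
elim: (repr x) => [|p s IH]; first by rewrite !big_nil tens_lift_zero.
by rewrite !big_cons IH tens_lift_add // tens_lift_pure.
Qed.

Lemma tens_ind (P : tensor -> Prop) :
  P 0 -> (forall x y, P x -> P y -> P (x + y)) -> (forall a b, P (pure_tensor a b)) ->
  forall x, P x.
Proof.
move=> P0 PD Pp x; have [s ->] := tensorE x.
by elim: s => [|p s IH]; rewrite ?big_nil // big_cons; apply: PD.
Qed.
End Tensor.

Notation "a ⊗ b" := (pure_tensor a b) : ring_scope.

Lemma pure_tensorBl (F : fieldType) (A B : lmodType F) (a a' : A) (b : B) :
  (a - a') ⊗ b = a ⊗ b - a' ⊗ b.
Proof.
have PB := pure_tensor_bilinear A B.
by rewrite -scaleN1r addrC PB.1 /= scaleN1r addrC.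
Qed.

Lemma pure_tensorBr (F : fieldType) (A B : lmodType F) (a : A) (b b' : B) :
  a ⊗ (b - b') = a ⊗ b - a ⊗ b'.
Proof.
have PB := pure_tensor_bilinear A B.
by rewrite -scaleN1r addrC PB.2 /= scaleN1r addrC.
Qed.

Section TensorAlgebra.
Variables (F : fieldType) (A B : algType F).
Local Notation AB := (tensor A B).

Definition tens_mul (x y : AB) : AB :=
  tens_lift (fun a b => tens_lift (fun a' b' => (a * a') ⊗ (b * b')) y) x.
Definition tens_one : AB := 1 ⊗ 1.

Let inner_bilinear a b :
  bilinear_for *:%R *:%R (fun (a' : A) (b' : B) => (a * a') ⊗ (b * b') : AB).
Proof.
split=> [y c x x'|x c y y'] /=; rewrite mulrDr -scalerAr.
  exact: (pure_tensor_bilinear A B).1.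
exact: (pure_tensor_bilinear A B).2.
Qed.

Let outer_bilinear y : bilinear_for *:%R *:%R
  (fun (a : A) (b : B) => tens_lift (fun a' b' => (a * a') ⊗ (b * b') : AB) y).
Proof.
have PB := pure_tensor_bilinear A B.
by split=> [b c x x'|a c b b'] /=; rewrite /tens_lift /tens_eval scaler_sumr -big_split;
  apply: eq_bigr => p _ /=; rewrite mulrDl -scalerAl ?PB.1 ?PB.2.
Qed.

Lemma tens_mul_bilinear : bilinear_for *:%R *:%R tens_mul.
Proof.
split=> [y|x]; first exact: tens_lift_linear.
move=> c y y'; rewrite /tens_mul /= {1 4 5}/tens_lift /tens_eval.
rewrite scaler_sumr -big_split; apply: eq_bigr => p _ /=.
exact: tens_lift_linear.
Qed.

Lemma tens_mul_pure a b a' b' :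
  tens_mul (a ⊗ b) (a' ⊗ b') = (a * a') ⊗ (b * b').
Proof. by rewrite /tens_mul !tens_lift_pure. Qed.

Let mulB := tens_mul_bilinear.
Let mul0l y := bilin0l mulB y.
Let mul0r x := bilin0r mulB x.
Fact tens_mulDl : left_distributive tens_mul +%R.
Proof. by move=> x y z; apply: (bilinDl mulB). Qed.
Fact tens_mulDr : right_distributive tens_mul +%R.
Proof. by move=> x y z; apply: (bilinDr mulB). Qed.
Fact tens_mulA : associative tens_mul.
Proof.
elim/tens_ind=> [||a b] => [y z|x x' IH IH' y z|]; rewrite ?mul0l //.
  by rewrite !tens_mulDl IH IH'.
elim/tens_ind=> [||a' b'] => [z|y y' IH IH' z|]; rewrite ?mul0l ?mul0r ?mul0l //.
  by rewrite !(tens_mulDl, tens_mulDr) IH IH'.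
elim/tens_ind=> [|z z' IH IH'|a'' b'']; rewrite ?mul0r //.
  by rewrite !tens_mulDr IH IH'.
by rewrite !tens_mul_pure !mulrA.
Qed.
Fact tens_mul1l : left_id tens_one tens_mul.
Proof.
elim/tens_ind=> [|x y IH IH'|a b]; rewrite ?mul0r //.
  by rewrite tens_mulDr IH IH'.
by rewrite tens_mul_pure !mul1r.
Qed.
Fact tens_mul1r : right_id tens_one tens_mul.
Proof.
elim/tens_ind=> [|x y IH IH'|a b]; rewrite ?mul0l //.
  by rewrite tens_mulDl IH IH'.
by rewrite tens_mul_pure !mulr1.
Qed.
Fact tens_one_neq0 : tens_one != 0.
Proof.
have [l [lL l1]] := separating_functional (oner_neq0 A).
have [l' [lL' l1']] := separating_functional (oner_neq0 B).
pose b (x : A) (y : B) : F^o := l x * l' y.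
have bP : bilinear_for *:%R *:%R b.
  split=> [y c x x'|x c y y']; rewrite /b /= ?lL ?lL'.
    by rewrite mulrDl -scalerAl.
  by rewrite mulrDr -scalerAr.
apply/eqP => /(congr1 (tens_lift b)).
rewrite tens_lift_pure // tens_lift_zero // /b l1 l1' mulr1 => /eqP.
by rewrite oner_eq0.
Qed.
HB.instance Definition _ := GRing.Zmodule_isNzRing.Build AB
  tens_mulA tens_mul1l tens_mul1r tens_mulDl tens_mulDr tens_one_neq0.
HB.instance Definition _ := GRing.Lmodule_isLalgebra.Build F AB
  (fun c x y => esym (bilinZl mulB c x y)).
HB.instance Definition _ := GRing.Lalgebra_isAlgebra.Build F AB
  (fun c x y => esym (bilinZr mulB c x y)).
Lemma pure_tensorM (a a' : A) (b b' : B) :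
  (a ⊗ b : AB) * (a' ⊗ b') = (a * a') ⊗ (b * b').
Proof. exact: tens_mul_pure. Qed.
End TensorAlgebra.

Section TensorMaps.
Variables (F : fieldType).

Definition tens_map (A B A' B' : lmodType F) (f : A -> A') (g : B -> B') :
    tensor A B -> tensor A' B' :=
  tens_lift (fun a b => f a ⊗ g b).

Definition tens_assoc (A B C : lmodType F) :
    tensor A (tensor B C) -> tensor (tensor A B) C :=
  tens_lift (fun a => tens_lift (fun b c => (a ⊗ b) ⊗ c)).

End TensorMaps.

HB.mixin Record Lmodule_isLie (F : fieldType) L of GRing.Lmodule F L := {
  lie : L -> L -> L;
  lie_bilinear : bilinear_for *:%R *:%R lie;
  lie_alt : forall x, lie x x = 0;
  lie_jacobi : forall x y z,
    lie x (lie y z) + lie y (lie z x) + lie z (lie x y) = 0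
}.

#[short(type="lieType")]
HB.structure Definition Lie (F : fieldType) :=
  {L of GRing.Lmodule F L & Lmodule_isLie F L}.

Section Enveloping.
Variables (F : fieldType) (L : lieType F).

Record lieHom (A : algType F) := LieHom {
  lieHom_fun :> L -> A;
  lieHom_linear : linear lieHom_fun;
  lieHom_lie : forall x y, lieHom_fun (lie x y) =
    lieHom_fun x * lieHom_fun y - lieHom_fun y * lieHom_fun x
}.

(* U(L): noncommutative polynomial expressions in the elements of L, two
   expressions being identified when they have the same value under every Lie
   algebra map from L to an associative unital algebra.  U(L) is itself such an
   algebra, so this is the quotient of the free algebra by the relations of
   linearity and x y - y x = [x, y]. *)
Inductive env_term :=
  | EnvGen of L
  | EnvConst of F
  | EnvAdd of env_term & env_term
  | EnvMul of env_term & env_term.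
HB.instance Definition _ := gen_eqMixin env_term.
HB.instance Definition _ := gen_choiceMixin env_term.

Fixpoint env_eval (A : algType F) (phi : L -> A) (t : env_term) : A :=
  match t with
  | EnvGen x => phi x
  | EnvConst c => c%:A
  | EnvAdd t u => env_eval phi t + env_eval phi u
  | EnvMul t u => env_eval phi t * env_eval phi u
  end.

Definition env_eqv (t u : env_term) : bool :=
  `[< forall (A : algType F) (phi : lieHom A), env_eval phi t = env_eval phi u >].

Lemma env_eqv_equiv : equiv_class_of env_eqv.
Proof.
split.
- by move=> s; apply/asboolP.
- by move=> s t; apply/idP/idP => /asboolP E; apply/asboolP => A phi; rewrite E.
- move=> t s u /asboolP E /asboolP E'; apply/asboolP => A phi.
  by rewrite E E'.
Qed.
Canonical env_eqv_rel := EquivRelPack env_eqv_equiv.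

Definition envalg : Type := {eq_quot env_eqv_rel}.
HB.instance Definition _ := Choice.on envalg.
HB.instance Definition _ := EqQuotient.on envalg.

Definition env_inj (x : L) : envalg := \pi_envalg (EnvGen x).

Definition env_lift (A : algType F) (phi : lieHom A) (u : envalg) : A :=
  env_eval phi (repr u).

Section Lift.
Variables (A : algType F) (phi : lieHom A).
Lemma env_lift_pi t : env_lift phi (\pi_envalg t) = env_eval phi t.
Proof.
rewrite /env_lift.
have /eqquotP/asboolP -> // : repr (\pi_envalg t) = t %[mod envalg].
by rewrite reprK.
Qed.
End Lift.

Lemma env_ext u v :
  (forall (A : algType F) (phi : lieHom A), env_lift phi u = env_lift phi v) ->
  u = v.
Proof.
move=> E; rewrite -[u]reprK -[v]reprK; apply/eqquotP/asboolP => A phi.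
exact: E.
Qed.

Definition env_const c := \pi_envalg (EnvConst c).
Definition env_add (u v : envalg) := \pi_envalg (EnvAdd (repr u) (repr v)).
Definition env_mul (u v : envalg) := \pi_envalg (EnvMul (repr u) (repr v)).

Section Eval.
Variables (A : algType F) (phi : lieHom A).
Lemma env_lift_const c : env_lift phi (env_const c) = c%:A.
Proof. by rewrite env_lift_pi. Qed.
Lemma env_lift_add u v :
  env_lift phi (env_add u v) = env_lift phi u + env_lift phi v.
Proof. by rewrite env_lift_pi. Qed.
Lemma env_lift_mul u v :
  env_lift phi (env_mul u v) = env_lift phi u * env_lift phi v.
Proof. by rewrite env_lift_pi. Qed.
Lemma env_lift_inj x : env_lift phi (env_inj x) = phi x.
Proof. by rewrite env_lift_pi. Qed.
End Eval.
Let envE := (env_lift_const, env_lift_add, env_lift_mul).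

Fact env_addA : associative env_add.
Proof. by move=> x y z; apply: env_ext => A phi; rewrite !envE addrA. Qed.
Fact env_addC : commutative env_add.
Proof. by move=> x y; apply: env_ext => A phi; rewrite !envE addrC. Qed.
Fact env_add0 : left_id (env_const 0) env_add.
Proof. by move=> x; apply: env_ext => A phi; rewrite !envE scale0r add0r. Qed.
Fact env_addN : left_inverse (env_const 0) (env_mul (env_const (-1))) env_add.
Proof.
move=> x; apply: env_ext => A phi.
by rewrite !envE scale0r mulr_algl scaleN1r addNr.
Qed.
HB.instance Definition _ :=
  GRing.isZmodule.Build envalg env_addA env_addC env_add0 env_addN.

Fact env_mulA : associative env_mul.
Proof. by move=> x y z; apply: env_ext => A phi; rewrite !envE mulrA. Qed.
Fact env_mul1l : left_id (env_const 1) env_mul.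
Proof. by move=> x; apply: env_ext => A phi; rewrite !envE scale1r mul1r. Qed.
Fact env_mul1r : right_id (env_const 1) env_mul.
Proof. by move=> x; apply: env_ext => A phi; rewrite !envE scale1r mulr1. Qed.
Fact env_mulDl : left_distributive env_mul +%R.
Proof. by move=> x y z; apply: env_ext => A phi; rewrite !envE mulrDl. Qed.
Fact env_mulDr : right_distributive env_mul +%R.
Proof. by move=> x y z; apply: env_ext => A phi; rewrite !envE mulrDr. Qed.

Fact counit_linear : linear (fun _ : L => 0 : F^o).
Proof. by move=> c x y; rewrite scaler0 addr0. Qed.
Fact counit_lie (x y : L) : (0 : F^o) = 0 * 0 - 0 * 0.
Proof. by rewrite mul0r subr0. Qed.
Definition counit_hom : lieHom F^o := LieHom counit_linear counit_lie.

Definition counit : envalg -> F^o := env_lift counit_hom.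

Fact env_one_neq0 : env_const 1 != 0.
Proof.
apply/eqP => /(congr1 counit); rewrite /counit !envE scale0r scale1r => /eqP.
by rewrite oner_eq0.
Qed.
HB.instance Definition _ := GRing.Zmodule_isNzRing.Build envalg
  env_mulA env_mul1l env_mul1r env_mulDl env_mulDr env_one_neq0.

Definition env_scale c u := env_mul (env_const c) u.
Fact env_scaleA c d x : env_scale c (env_scale d x) = env_scale (c * d) x.
Proof.
by apply: env_ext => A phi; rewrite !envE !mulr_algl scalerA.
Qed.
Fact env_scale1 : left_id 1 env_scale.
Proof. exact: env_mul1l. Qed.
Fact env_scaleDr : right_distributive env_scale +%R.
Proof. by move=> c x y; apply: env_mulDr. Qed.
Fact env_scaleDl x : {morph env_scale^~ x : c d / c + d}.
Proof.
by move=> c d; apply: env_ext => A phi; rewrite !envE !mulr_algl scalerDl.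
Qed.
HB.instance Definition _ := GRing.Zmodule_isLmodule.Build F envalg
  env_scaleA env_scale1 env_scaleDr env_scaleDl.
Fact env_scaleAl c (u v : envalg) : c *: (u * v) = (c *: u) * v.
Proof. exact: env_mulA. Qed.
HB.instance Definition _ := GRing.Lmodule_isLalgebra.Build F envalg env_scaleAl.
Fact env_scaleAr c (u v : envalg) : c *: (u * v) = u * (c *: v).
Proof.
by apply: env_ext => A phi; rewrite !envE !mulr_algl scalerAr.
Qed.
HB.instance Definition _ := GRing.Lalgebra_isAlgebra.Build F envalg env_scaleAr.

Fact env_inj_linear : linear env_inj.
Proof.
move=> c x y; apply: env_ext => A phi.
by rewrite !envE !env_lift_inj mulr_algl lieHom_linear.
Qed.
Fact env_inj_lie x y :
  env_inj (lie x y) = env_inj x * env_inj y - env_inj y * env_inj x.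
Proof.
apply: env_ext => A phi.
by rewrite !envE !env_lift_inj mulr_algl scaleN1r lieHom_lie.
Qed.
Definition env_hom : lieHom envalg := LieHom env_inj_linear env_inj_lie.

Section LiftMorphism.
Variables (A : algType F) (phi : lieHom A).
Fact env_lift_linear : linear (env_lift phi).
Proof. by move=> c u v; rewrite !envE mulr_algl. Qed.
Fact env_lift_monoid_morphism : monoid_morphism (env_lift phi).
Proof. by split=> [|u v]; rewrite !envE // scale1r. Qed.
HB.instance Definition _ := GRing.isLinear.Build F envalg A _ (env_lift phi)
  env_lift_linear.
HB.instance Definition _ :=
  GRing.isMonoidMorphism.Build envalg A (env_lift phi) env_lift_monoid_morphism.
End LiftMorphism.

(* Delta is the algebra map with Delta x = x (x) 1 + 1 (x) x on L. *)
Definition coproduct_gen (x : L) : tensor envalg envalg :=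
  env_inj x ⊗ 1 + 1 ⊗ env_inj x.
Fact coproduct_linear : linear coproduct_gen.
Proof.
move=> c x y; rewrite /coproduct_gen env_inj_linear.
have PB := pure_tensor_bilinear envalg envalg.
by rewrite PB.1 PB.2 /= scalerDr addrACA.
Qed.
Fact coproduct_lie x y : coproduct_gen (lie x y) =
  coproduct_gen x * coproduct_gen y - coproduct_gen y * coproduct_gen x.
Proof.
rewrite /coproduct_gen env_inj_lie !mulrDl !mulrDr !pure_tensorM !mulr1 !mul1r.
rewrite pure_tensorBl pure_tensorBr; apply/eqP; rewrite eq_sym subr_eq eq_sym.
apply/eqP; rewrite (AC ((2*2)*(2*2)) (((1*7)*(6*3))*(2*5)*(4*8))).
by rewrite /= !addNr !addr0.
Qed.
Definition coproduct_hom : lieHom (tensor envalg envalg) :=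
  LieHom coproduct_linear coproduct_lie.

Definition coproduct : envalg -> tensor envalg envalg := env_lift coproduct_hom.

End Enveloping.

(* fps A is A[[t]], t the deformation parameter: the t-adically completed
   extension of A, so that a twist lives in (U (x) U)[[t]], which contains
   U (x) U as its constant series.  Linear and bilinear maps are extended
   coefficientwise by fps_map and fps_conv. *)
Definition fps (A : Type) : Type := nat -> A.

Definition fps_map (A B : Type) (f : A -> B) (x : fps A) : fps B :=
  fun n => f (x n).

Definition fps_const (A : nmodType) (a : A) : fps A :=
  fun n => if n == 0%N then a else 0.

Definition fps_conv (A B : Type) (W : nmodType) (b : A -> B -> W)
    (x : fps A) (y : fps B) : fps W :=
  fun n => \sum_(i < n.+1) b (x i) (y (n - i)%N).

HB.instance Definition _ (A : zmodType) :=
  GRing.Zmodule.copy (fps A) (nat -> A).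
HB.instance Definition _ (F : fieldType) (A : lmodType F) :=
  GRing.Lmodule.copy (fps A) (nat -> A).

Section FpsAlgebra.
Variables (F : fieldType) (A : algType F).
Implicit Types x y z : fps A.

Definition fps_mul : fps A -> fps A -> fps A := fps_conv *%R.

Fact fps_mul_rev x y n : fps_mul x y n = \sum_(i < n.+1) x (n - i)%N * y i.
Proof.
rewrite /fps_mul /fps_conv (reindex_inj rev_ord_inj) /=.
by apply: eq_bigr => j _; rewrite (sub_ordK j).
Qed.
Fact fps_mulA : associative fps_mul.
Proof.
move=> p q r; apply/funext=> i; rewrite [LHS]/fps_mul /fps_conv fps_mul_rev.
pose coef3 j k := p j * (q (i - j - k)%N * r k).
transitivity (\sum_(j < i.+1) \sum_(k < i.+1 | (k <= i - j)%N) coef3 j k).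
  apply: eq_bigr => /= j _; rewrite -/(fps_mul q r) fps_mul_rev big_distrr /=.
  by rewrite (big_ord_narrow_leq (leq_subr _ _)).
rewrite (exchange_big_dep predT) //=; apply: eq_bigr => k _.
transitivity (\sum_(j < i.+1 | (j <= i - k)%N) coef3 j k).
  apply: eq_bigl => j; rewrite -ltnS -(ltnS j) -!subSn ?leq_ord //.
  by rewrite -subn_gt0 -(subn_gt0 j) -!subnDA addnC.
rewrite (big_ord_narrow_leq (leq_subr _ _)) /fps_mul /fps_conv big_distrl /=.
by apply: eq_bigr => j _; rewrite /coef3 -!subnDA addnC mulrA.
Qed.
Fact fps_mul1l : left_id (fps_const 1) fps_mul.
Proof.
move=> x; apply/funext=> n; rewrite /fps_mul /fps_conv big_ord_recl subn0 mul1r.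
by rewrite big1 ?addr0 // => i _; rewrite /fps_const /= mul0r.
Qed.
Fact fps_mul1r : right_id (fps_const 1) fps_mul.
Proof.
move=> x; apply/funext=> n; rewrite fps_mul_rev big_ord_recl subn0 mulr1.
by rewrite big1 ?addr0 // => i _; rewrite /fps_const /= mulr0.
Qed.
Fact fps_mulDl : left_distributive fps_mul +%R.
Proof.
move=> x y z; apply/funext=> n.
change (fps_mul (x + y) z n = fps_mul x z n + fps_mul y z n).
rewrite /fps_mul /fps_conv -big_split /=.
by apply: eq_bigr => i _; rewrite -mulrDl.
Qed.
Fact fps_mulDr : right_distributive fps_mul +%R.
Proof.
move=> x y z; apply/funext=> n.
change (fps_mul x (y + z) n = fps_mul x y n + fps_mul x z n).
rewrite /fps_mul /fps_conv -big_split /=.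
by apply: eq_bigr => i _; rewrite -mulrDr.
Qed.
Fact fps_one_neq0 : fps_const (1 : A) != 0.
Proof.
by apply/eqP => /(congr1 (fun x : fps A => x 0%N)) /eqP; rewrite oner_eq0.
Qed.
HB.instance Definition _ := GRing.Zmodule_isNzRing.Build (fps A)
  fps_mulA fps_mul1l fps_mul1r fps_mulDl fps_mulDr fps_one_neq0.
Fact fps_scaleAl c x y : c *: (x * y) = (c *: x) * y.
Proof.
apply/funext => n; change (c *: fps_mul x y n = fps_mul (c *: x) y n).
rewrite /fps_mul /fps_conv scaler_sumr; apply: eq_bigr => i _.
exact: scalerAl.
Qed.
HB.instance Definition _ := GRing.Lmodule_isLalgebra.Build F (fps A) fps_scaleAl.
Fact fps_scaleAr c x y : c *: (x * y) = x * (c *: y).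
Proof.
apply/funext => n; change (c *: fps_mul x y n = fps_mul x (c *: y) n).
rewrite /fps_mul /fps_conv scaler_sumr; apply: eq_bigr => i _.
exact: scalerAr.
Qed.
HB.instance Definition _ := GRing.Lalgebra_isAlgebra.Build F (fps A) fps_scaleAr.
End FpsAlgebra.

(* Linear endomorphisms of the vector space underlying V, with composition as
   product; V is taken to be an algebra only so that it is nonzero. *)
Section Endomorphisms.
Variables (F : fieldType) (V : algType F).

Definition is_endo : {pred V -> V} := fun f => `[< linear f >].
Record endo := Endo { endo_fun :> V -> V; _ : endo_fun \in is_endo }.
HB.instance Definition _ := [isSub for endo_fun].
HB.instance Definition _ := [Choice of endo by <:].

Lemma endoP (f : endo) : linear f.
Proof. by apply/asboolP; case: f. Qed.

Fact is_endo_submod : submod_closed is_endo.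
Proof.
split; first by apply/asboolP => c x y; rewrite /= scaler0 addr0.
move=> d f g /asboolP fP /asboolP gP; apply/asboolP => c x y.
change (d *: f (c *: x + y) + g (c *: x + y) =
  c *: (d *: f x + g x) + (d *: f y + g y)).
by rewrite fP gP !scalerDr !scalerA [d * c]mulrC addrACA.
Qed.
HB.instance Definition _ := GRing.isSubmodClosed.Build F (V -> V) is_endo
  is_endo_submod.
HB.instance Definition _ := [SubChoice_isSubLmodule of endo by <:].

Fact endo_comp_subproof (f g : endo) : (fun x => f (g x)) \in is_endo.
Proof. by apply/asboolP => c x y; rewrite !endoP. Qed.
Definition endo_comp (f g : endo) : endo := Endo (endo_comp_subproof f g).
Fact endo_id_subproof : (fun x => x) \in is_endo.
Proof. exact/asboolP. Qed.
Definition endo_id : endo := Endo endo_id_subproof.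

Lemma endo_eq (f g : endo) : f =1 g -> f = g.
Proof. by move=> fg; apply/val_inj/funext. Qed.

Fact endo_mulA : associative endo_comp.
Proof. by move=> f g h; apply: endo_eq. Qed.
Fact endo_mul1l : left_id endo_id endo_comp.
Proof. by move=> f; apply: endo_eq. Qed.
Fact endo_mul1r : right_id endo_id endo_comp.
Proof. by move=> f; apply: endo_eq. Qed.
Fact endo_mulDl : left_distributive endo_comp +%R.
Proof. by move=> f g h; apply: endo_eq. Qed.
Fact endo_mulDr : right_distributive endo_comp +%R.
Proof.
move=> f g h; apply: endo_eq => x.
change (f (g x + h x) = f (g x) + f (h x)).
by have := endoP f 1 (g x) (h x); rewrite !scale1r.
Qed.
Fact endo_one_neq0 : endo_id != 0.
Proof.
by apply/eqP => /(congr1 (fun f : endo => f 1)) /= /eqP; rewrite oner_eq0.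
Qed.
HB.instance Definition _ := GRing.Zmodule_isNzRing.Build endo
  endo_mulA endo_mul1l endo_mul1r endo_mulDl endo_mulDr endo_one_neq0.
Fact endo_scaleAl c (f g : endo) : c *: (f * g) = (c *: f) * g.
Proof. by apply: endo_eq. Qed.
HB.instance Definition _ := GRing.Lmodule_isLalgebra.Build F endo endo_scaleAl.
Fact endo_scaleAr c (f g : endo) : c *: (f * g) = f * (c *: g).
Proof.
apply: endo_eq => x; change (c *: f (g x) = f (c *: g x)).
have f0 : f 0 = 0.
  by have := endoP f (-1) 0 0; rewrite scaler0 addr0 scaleN1r addNr.
by have := endoP f c (g x) 0; rewrite f0 !addr0.
Qed.
HB.instance Definition _ := GRing.Lalgebra_isAlgebra.Build F endo endo_scaleAr.

Lemma endoDE (f g : endo) x : (f + g) x = f x + g x. Proof. by []. Qed.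
Lemma endoBE (f g : endo) x : (f - g) x = f x - g x. Proof. by []. Qed.
Lemma endoZE c (f : endo) x : (c *: f) x = c *: f x. Proof. by []. Qed.
Lemma endoME (f g : endo) x : (f * g) x = f (g x). Proof. by []. Qed.
End Endomorphisms.

Section PowerSeries.
Variables (F : fieldType) (n : nat).

(* Formal power series in n commuting variables: the coefficient function on
   monomials. *)
Definition pseries : Type := 'X_{1..n} -> F^o.
HB.instance Definition _ := GRing.Lmodule.copy pseries ('X_{1..n} -> F^o).
Implicit Types f g h : pseries.

Definition ps_mul f g : pseries := fun a =>
  \sum_(k : 'X_{1..n < (mdeg a).+1, (mdeg a).+1} | a == (k.1 + k.2)%MM)
    (f k.1 * g k.2).

Definition ps_trunc d f : {mpoly F[n]} :=
  \sum_(k : 'X_{1..n < d}) f k *: 'X_[k].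

Lemma ps_truncE d f a : (mdeg a < d)%N -> (ps_trunc d f)@_a = f a.
Proof. exact: mcoeff_mpoly. Qed.

Lemma ps_mulE_agree (p q : {mpoly F[n]}) f g a :
  (forall b, (mdeg b <= mdeg a)%N -> p@_b = f b) ->
  (forall b, (mdeg b <= mdeg a)%N -> q@_b = g b) ->
  (p * q)@_a = ps_mul f g a.
Proof.
move=> pf qg; rewrite mcoeffM; apply: eq_bigr => -[[b /= hb] [c /= hc]] _.
by rewrite pf ?qg.
Qed.

Lemma ps_mulE d f g a : (mdeg a < d)%N ->
  ps_mul f g a = (ps_trunc d f * ps_trunc d g)@_a.
Proof.
by move=> ad; apply/esym/ps_mulE_agree => b ba;
  rewrite ps_truncE // (leq_ltn_trans ba).
Qed.

Definition ps_const (c : F) : pseries := fun a => if a == 0%MM then c else 0.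

Lemma ps_trunc_const d c : (0 < d)%N -> ps_trunc d (ps_const c) = c%:MP.
Proof.
move=> d0; have z0 : (mdeg (0%MM : 'X_{1..n}) < d)%N by rewrite mdeg0.
rewrite /ps_trunc (bigD1 (Sub 0%MM z0)) //= big1 ?addr0 => [|k].
  by rewrite /ps_const /= eqxx mpolyX0 alg_mpolyC.
by rewrite /ps_const -val_eqE /= => /negbTE ->; rewrite scale0r.
Qed.

Lemma ps_trunc_const' d f : 
  (0 < d)%N -> ps_trunc d (ps_const 1) * ps_trunc d f = ps_trunc d f.
Proof. by move=> d0; rewrite ps_trunc_const // mul1r. Qed.

Fact ps_mulA : associative ps_mul.
Proof.
move=> f g h; apply/funext => a; pose T := ps_trunc (mdeg a).+1.
have ag k b : (mdeg b <= mdeg a)%N -> (T k)@_b = k b.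
  by move=> ba; rewrite ps_truncE.
have agM k l b : (mdeg b <= mdeg a)%N -> (T k * T l)@_b = ps_mul k l b.
  by move=> ba; rewrite -ps_mulE.
rewrite -(ps_mulE_agree (ag f) (agM g h)) -(ps_mulE_agree (agM f g) (ag h)).
by rewrite mulrA.
Qed.
Fact ps_mulC : commutative ps_mul.
Proof.
by move=> f g; apply/funext => a; rewrite !(@ps_mulE (mdeg a).+1) // mulrC.
Qed.
Fact ps_mul1 : left_id (ps_const 1) ps_mul.
Proof.
move=> f; apply/funext => a.
by rewrite (@ps_mulE (mdeg a).+1) // ps_trunc_const' // ps_truncE.
Qed.
Fact ps_mulDl : left_distributive ps_mul +%R.
Proof.
move=> f g h; apply/funext => a.
change (ps_mul (f + g) h a = ps_mul f h a + ps_mul g h a).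
rewrite /ps_mul -big_split /=.
by apply: eq_bigr => k _; rewrite -mulrDl.
Qed.
Fact ps_one_neq0 : ps_const 1 != 0.
Proof.
apply/eqP => /(congr1 (fun f : pseries => f 0%MM)) /eqP.
by rewrite /ps_const eqxx oner_eq0.
Qed.
HB.instance Definition _ := GRing.Zmodule_isComNzRing.Build pseries
  ps_mulA ps_mulC ps_mul1 ps_mulDl ps_one_neq0.
Fact ps_scaleAl c f g : c *: (f * g) = (c *: f) * g.
Proof.
apply/funext => a; change (c *: ps_mul f g a = ps_mul (c *: f) g a).
rewrite /ps_mul scaler_sumr; apply: eq_bigr => i _; exact: scalerAl.
Qed.
HB.instance Definition _ := GRing.Lmodule_isLalgebra.Build F pseries ps_scaleAl.
HB.instance Definition _ := GRing.Lalgebra_isComAlgebra.Build F pseries.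

Definition ps_var (mu : 'I_n) : pseries := fun a => if a == U_(mu)%MM then 1 else 0.

Definition ps_deriv (mu : 'I_n) f : pseries := fun a =>
  f (a + U_(mu))%MM *+ (a mu).+1.

Fact ps_deriv_linear mu : linear (ps_deriv mu).
Proof.
move=> c f g; apply/funext => a.
change ((c * f (a + U_(mu))%MM + g (a + U_(mu))%MM) *+ (a mu).+1 =
  c * (f (a + U_(mu))%MM *+ (a mu).+1) + g (a + U_(mu))%MM *+ (a mu).+1).
by rewrite mulrnDl mulrnAr.
Qed.

Lemma ps_deriv_trunc d mu f a : (mdeg a < d)%N ->
  (ps_trunc d.+1 f)^`M(mu)@_a = ps_deriv mu f a.
Proof.
by move=> ad; rewrite mcoeff_deriv ps_truncE // mdegD mdeg1 addn1.
Qed.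

Lemma ps_derivM mu f g :
  ps_deriv mu (f * g) = ps_deriv mu f * g + f * ps_deriv mu g.
Proof.
apply/funext => a; set d := (mdeg a).+1.
have ad : (mdeg a < d)%N by [].
change (ps_mul f g (a + U_(mu))%MM *+ (a mu).+1 =
  ps_mul (ps_deriv mu f) g a + ps_mul f (ps_deriv mu g) a).
rewrite (@ps_mulE d.+1) ?mdegD ?mdeg1 ?addn1 // -mcoeff_deriv mderivM mcoeffD.
have ag k b : (mdeg b <= mdeg a)%N -> (ps_trunc d.+1 k)@_b = k b.
  by move=> ba; rewrite ps_truncE // ltnS (leq_trans ba).
have agd k b : (mdeg b <= mdeg a)%N ->
    (ps_trunc d.+1 k)^`M(mu)@_b = ps_deriv mu k b.
  by move=> ba; rewrite ps_deriv_trunc.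
by rewrite (ps_mulE_agree (agd f) (ag g)) (ps_mulE_agree (ag f) (agd g)).
Qed.

Lemma ps_derivC mu nu f :
  ps_deriv mu (ps_deriv nu f) = ps_deriv nu (ps_deriv mu f).
Proof.
apply/funext => a; rewrite /ps_deriv -!mulrnA !mnmDE !mnm1E.
rewrite -!addmA [(U_(mu) + _)%MM]addmC; congr (_ *+ _).
have [->|mn] := eqVneq mu nu; first by [].
by rewrite ?[nu == mu]eq_sym ?(negbTE mn) !addn0 mulnC.
Qed.

Lemma ps_deriv_var mu nu :
  ps_deriv mu (ps_var nu) = if mu == nu then 1 else 0.
Proof.
apply/funext => a; rewrite /ps_deriv /ps_var.
have [->|mn] := eqVneq mu nu.
  have -> : ((a + U_(nu))%MM == U_(nu)%MM) = (a == 0%MM).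
    by rewrite -{2}[U_(nu)%MM]add0m eqm_add2r.
  rewrite /GRing.one /= /ps_const; case: eqP => [->|_]; last by rewrite mul0rn.
  by rewrite mnm0E.
case: eqP => [/(congr1 (fun m : 'X_{1..n} => m mu))|_]; last by rewrite mul0rn.
by rewrite mnmDE !mnm1E eqxx eq_sym (negbTE mn) addn1.
Qed.
End PowerSeries.

Section DifferentialOperators.
Variables (F : fieldType) (n : nat).
Local Notation M := (pseries F n).

Fact mul_op_subproof (f : M) : (fun g : M => f * g) \in @is_endo F M.
Proof. by apply/asboolP => c x y; rewrite mulrDr scalerAr. Qed.
Definition mul_op (f : M) : endo M := Endo (mul_op_subproof f).

Fact deriv_op_subproof (mu : 'I_n) : @ps_deriv F n mu \in @is_endo F M.
Proof. by apply/asboolP; apply: ps_deriv_linear. Qed.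
Definition deriv_op (mu : 'I_n) : endo M := Endo (deriv_op_subproof mu).

(* Diff(M) is the subalgebra of End(M) generated by the multiplication operators
   and the partial derivatives. *)
Inductive diffop_gen : endo M -> Prop :=
  | diffop_gen_mul f : diffop_gen (mul_op f)
  | diffop_gen_deriv mu : diffop_gen (deriv_op mu)
  | diffop_gen_add A B : diffop_gen A -> diffop_gen B -> diffop_gen (A + B)
  | diffop_gen_comp A B : diffop_gen A -> diffop_gen B -> diffop_gen (A * B).

Definition is_diffop : {pred endo M} := fun A => `[< diffop_gen A >].
Record diffop := Diffop { diffop_endo :> endo M; _ : diffop_endo \in is_diffop }.
HB.instance Definition _ := [isSub for diffop_endo].
HB.instance Definition _ := [Choice of diffop by <:].

Fact is_diffop_subalg : subalg_closed is_diffop.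
Proof.
have scl c : c *: 1 = mul_op (c%:A) :> endo M.
  by apply: endo_eq => f; rewrite endoZE /= -scalerAl mul1r.
split.
- apply/asboolP; have -> : 1 = mul_op 1 :> endo M.
    by apply: endo_eq => f /=; rewrite mul1r.
  exact: diffop_gen_mul.
- move=> c A B /asboolP HA /asboolP HB; apply/asboolP.
  apply: diffop_gen_add HB; rewrite -[A]mul1r scalerAl scl.
  by apply: diffop_gen_comp HA; apply: diffop_gen_mul.
- move=> A B /asboolP HA /asboolP HB; apply/asboolP.
  exact: diffop_gen_comp.
Qed.
HB.instance Definition _ :=
  GRing.isSubalgClosed.Build F (endo M) is_diffop is_diffop_subalg.
HB.instance Definition _ := [SubChoice_isSubLalgebra of diffop by <:].
HB.instance Definition _ := [SubLalgebra_isSubAlgebra of diffop by <:].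

Lemma diffop_eq (A B : diffop) : (forall f : M, A f = B f) -> A = B.
Proof. by move=> AB; apply/val_inj/endo_eq. Qed.

Fact coord_subproof mu : mul_op (ps_var F mu) \in is_diffop.
Proof. by apply/asboolP; apply: diffop_gen_mul. Qed.
Definition coord mu : diffop := Diffop (coord_subproof mu).

Fact partial_subproof mu : deriv_op mu \in is_diffop.
Proof. by apply/asboolP; apply: diffop_gen_deriv. Qed.
Definition partial mu : diffop := Diffop (partial_subproof mu).

Lemma partialC mu nu : partial mu * partial nu = partial nu * partial mu.
Proof. by apply: diffop_eq => f; apply: ps_derivC. Qed.

Lemma coordC mu nu : coord mu * coord nu = coord nu * coord mu.
Proof.
apply: diffop_eq => f.
change (ps_var F mu * (ps_var F nu * f) = ps_var F nu * (ps_var F mu * f)).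
by rewrite mulrCA.
Qed.

Lemma partial_coord mu nu :
  partial mu * coord nu = (mu == nu)%:R + coord nu * partial mu.
Proof.
apply: diffop_eq => f.
change (ps_deriv mu (ps_var F nu * f) =
  endo_fun (diffop_endo (mu == nu)%:R) f + ps_var F nu * ps_deriv mu f).
rewrite ps_derivM ps_deriv_var; congr (_ + _).
by case: eqP => _; rewrite ?mul1r ?mul0r.
Qed.
End DifferentialOperators.

Section Lorentz.
Variable F : fieldType.

(* diag(1, -1, -1, -1), index 0 being time.  This matrix is its own inverse, so it
   serves both as g_{mu nu} and as g^{mu nu}. *)
Definition metric : 'M[F]_4 :=
  \matrix_(mu, nu) if mu == nu then (if mu == 0 then 1 else -1) else 0.

(* Over F = C this is the complexification of so(1,3). *)
Definition is_so13 : {pred 'M[F]_4} :=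
  fun X => X^T *m metric + metric *m X == 0.
Record so13 := So13 { so13_mx :> 'M[F]_4; _ : so13_mx \in is_so13 }.
HB.instance Definition _ := [isSub for so13_mx].
HB.instance Definition _ := [Choice of so13 by <:].

Fact is_so13_submod : submod_closed is_so13.
Proof.
split=> [|c X Y /eqP HX /eqP HY].
  by rewrite unfold_in trmx0 mul0mx mulmx0 addr0.
rewrite unfold_in linearD linearZ /= mulmxDl mulmxDr -scalemxAl -scalemxAr.
by rewrite addrACA -scalerDr HX HY scaler0 addr0.
Qed.
HB.instance Definition _ := GRing.isSubmodClosed.Build F 'M[F]_4 is_so13
  is_so13_submod.
HB.instance Definition _ := [SubChoice_isSubLmodule of so13 by <:].

Lemma so13P (X : so13) : (X : 'M[F]_4)^T *m metric = - (metric *m X).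
Proof. by case: X => X HX /=; apply/eqP; rewrite -addr_eq0; exact: HX. Qed.

Fact so13_lie_subproof (X Y : so13) : (X *m Y - Y *m X : 'M[F]_4) \in is_so13.
Proof.
rewrite unfold_in linearB /= !trmx_mul mulmxBl mulmxBr -!mulmxA !so13P.
rewrite !mulmxN !mulmxA !so13P !mulNmx !opprK -!mulmxA.
by rewrite addrC -opprB addNr.
Qed.
Definition so13_lie (X Y : so13) : so13 := So13 (so13_lie_subproof X Y).

Fact so13_lie_bilinear : bilinear_for *:%R *:%R so13_lie.
Proof.
split=> [Y c X X'|X c Y Y']; apply: val_inj => /=.
  by rewrite mulmxDl mulmxDr -scalemxAl -scalemxAr scalerBr opprD addrACA.
by rewrite mulmxDl mulmxDr -scalemxAl -scalemxAr scalerBr opprD addrACA.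
Qed.
Fact so13_lie_alt X : so13_lie X X = 0.
Proof. by apply: val_inj; rewrite /= subrr. Qed.
Fact so13_lie_jacobi X Y Z :
  so13_lie X (so13_lie Y Z) + so13_lie Y (so13_lie Z X) +
  so13_lie Z (so13_lie X Y) = 0.
Proof.
apply: val_inj; rewrite /= !mulmxBl !mulmxBr !mulmxA !opprB.
move: (_ *m X *m Y) (_ *m Y *m X) (_ *m X *m Z) (_ *m Z *m X) (_ *m Y *m Z)
  (_ *m Z *m Y) => a b c d e f.
by apply/matrixP => i j; rewrite !mxE; ring.
Qed.
HB.instance Definition _ := Lmodule_isLie.Build F so13
  so13_lie_bilinear so13_lie_alt so13_lie_jacobi.
End Lorentz.

Section Action.
Variable F : fieldType.
Local Notation M := (pseries F 4).
Local Notation D := (diffop F 4).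
Local Notation L := (so13 F).
Local Notation U := (envalg L).

(* X acts on functions by (X f)(v) = d/ds f(exp(-s X) v) at s = 0, so that
   X z^mu = - sum_nu X mu nu z^nu, and X (f g) = (X f) g + f (X g). *)
Definition vector_field (X : 'M[F]_4) : D :=
  - \sum_mu \sum_nu X mu nu *: (coord F nu * partial F mu).

Fact vector_field_linear : linear vector_field.
Proof.
move=> c X Y; rewrite /vector_field scalerN -opprD; congr (- _).
rewrite scaler_sumr -big_split; apply: eq_bigr => mu _ /=.
rewrite scaler_sumr -big_split; apply: eq_bigr => nu _ /=.
by rewrite !mxE scalerDl scalerA.
Qed.

Let E mu nu : D := coord F nu * partial F mu.
Let EE mu nu ka la : E mu nu * E ka la - E ka la * E mu nu =
  (mu == la)%:R * E ka nu - (ka == nu)%:R * E mu la.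
Proof.
have mE a b c d : E a b * E c d =
    (a == d)%:R * E c b + coord F b * coord F d * partial F a * partial F c.
  rewrite /E !mulrA -[coord F b * _ * _]mulrA partial_coord mulrDr mulrDl.
  by rewrite !mulrA; congr (_ * _ + _); rewrite !mulr_natl mulr_natr.
rewrite !mE opprD addrACA [coord F la * _]coordC.
rewrite -[_ * partial F ka * partial F mu]mulrA partialC mulrA subrr addr0.
by [].
Qed.

Fact vector_field_lie (X Y : L) : vector_field (lie X Y) =
  vector_field X * vector_field Y - vector_field Y * vector_field X.
Proof.
pose S (Z : 'M[F]_4) : D := \sum_mu \sum_nu Z mu nu *: E mu nu.
have SP Z : S Z = \sum_(p : 'I_4 * 'I_4) Z p.1 p.2 *: E p.1 p.2.
  by rewrite /S pair_bigA.
have SM Z T : S (Z *m T) =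
    \sum_(p : 'I_4 * 'I_4) \sum_(q : 'I_4 * 'I_4)
      (Z p.1 p.2 * T q.1 q.2) *: ((q.1 == p.2)%:R * E p.1 q.2).
  rewrite -(pair_bigA _ (fun a b => \sum_(q : 'I_4 * 'I_4)
      (Z a b * T q.1 q.2) *: ((q.1 == b)%:R * E a q.2))) /S /=.
  apply: eq_bigr => a _.
  transitivity (\sum_d \sum_b (Z a b * T b d) *: E a d).
    by apply: eq_bigr => d _; rewrite mxE scaler_suml.
  rewrite exchange_big /=; apply: eq_bigr => b _.
  rewrite -(pair_bigA _ (fun c d => (Z a b * T c d) *: ((c == b)%:R * E a d))) /=.
  rewrite [in RHS](bigD1 b) //= [X in _ = _ + X]big1 ?addr0 => [|c /negbTE cb].
    by apply: eq_bigr => d _; rewrite eqxx mul1r.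
  by apply: big1 => d _; rewrite cb mul0r scaler0.
have vfE Z : vector_field Z = - S Z by [].
rewrite !vfE !mulrNN /= -[RHS]opprB; congr (- _).
transitivity (S ((X : 'M[F]_4) *m Y) - S ((Y : 'M[F]_4) *m X)).
  rewrite /S -sumrB; apply: eq_bigr => a _; rewrite -sumrB; apply: eq_bigr => b _.
  by rewrite !mxE scalerBl.
have prod Z T : S Z * S T = \sum_(p : 'I_4 * 'I_4) \sum_(q : 'I_4 * 'I_4)
    (Z p.1 p.2 * T q.1 q.2) *: (E p.1 p.2 * E q.1 q.2).
  rewrite !SP big_distrlr /=; apply: eq_bigr => p _; apply: eq_bigr => q _.
  by rewrite -scalerAl -scalerAr scalerA.
rewrite (prod Y X) (prod X Y) SM (SM Y X) [X in _ - X = _]exchange_big /=.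
rewrite [X in _ = X - _]exchange_big /= -!sumrB; apply: eq_bigr => p _.
rewrite -!sumrB; apply: eq_bigr => q _.
by rewrite [Y _ _ * X _ _]mulrC -!scalerBr EE.
Qed.

Definition action_fun_gen (X : L) : endo M := diffop_endo (vector_field X).
Fact action_fun_linear : linear action_fun_gen.
Proof. by move=> c X Y; rewrite /action_fun_gen vector_field_linear. Qed.
Fact action_fun_lie X Y : action_fun_gen (lie X Y) =
  action_fun_gen X * action_fun_gen Y - action_fun_gen Y * action_fun_gen X.
Proof. by rewrite /action_fun_gen vector_field_lie. Qed.
Definition action_fun_hom : lieHom L (endo M) :=
  LieHom action_fun_linear action_fun_lie.

Fact adjoint_subproof (X : L) :
  (fun A : D => vector_field X * A - A * vector_field X) \in @is_endo F D.
Proof.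
apply/asboolP => c A B; rewrite mulrDr mulrDl -scalerAl -scalerAr.
by rewrite scalerBr opprD addrACA.
Qed.
(* The adjoint action of a primitive element is the commutator with its action on
   functions, which is what X (A f) = (X A) f + A (X f) demands. *)
Definition action_diff_gen (X : L) : endo D := Endo (adjoint_subproof X).
Fact action_diff_linear : linear action_diff_gen.
Proof.
move=> c X Y; apply: endo_eq => A; rewrite endoDE endoZE /= vector_field_linear.
rewrite mulrDr mulrDl -scalerAl -scalerAr.
by rewrite scalerBr opprD addrACA.
Qed.
Fact action_diff_lie X Y : action_diff_gen (lie X Y) =
  action_diff_gen X * action_diff_gen Y - action_diff_gen Y * action_diff_gen X.
Proof.
apply: endo_eq => A; rewrite endoBE !endoME /= vector_field_lie.
move: (vector_field X) (vector_field Y) => x y.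
rewrite !(mulrBl, mulrBr) !mulrA !opprB.
rewrite [RHS](AC ((2*2)*(2*2)) (((1*8)*(3*6))*(2*5)*(4*7))).
by rewrite /= !addNr !addr0.
Qed.
Definition action_diff_hom : lieHom L (endo D) :=
  LieHom action_diff_linear action_diff_lie.

Definition action_fun (h : U) : M -> M := env_lift action_fun_hom h.
Definition action_diff (h : U) : D -> D := env_lift action_diff_hom h.
End Action.

Section TwistedOperations.
Variable F : fieldType.
Local Notation M := (pseries F 4).
Local Notation D := (diffop F 4).
Local Notation U := (envalg (so13 F)).

Definition coproduct_id : tensor U U -> tensor (tensor U U) U :=
  tens_map (@coproduct F (so13 F)) id.
Definition id_coproduct : tensor U U -> tensor U (tensor U U) :=
  tens_map id (@coproduct F (so13 F)).
Definition counit_id : tensor U U -> U :=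
  tens_lift (fun a b : U => (counit a : F) *: b).
Definition id_counit : tensor U U -> U :=
  tens_lift (fun a b : U => (counit b : F) *: a).

(* The two sides of the cocycle equation live in (U (x) U) (x) U and
   U (x) (U (x) U); tens_assoc identifies the latter with the former. *)
Record twist := Twist {
  twist_val :> fps (tensor U U);
  twist_inv : fps (tensor U U);
  twist_mulrV : twist_val * twist_inv = 1;
  twist_mulVr : twist_inv * twist_val = 1;
  twist_cocycle :
    fps_map coproduct_id twist_val * fps_map (fun x => x ⊗ 1) twist_val
    = fps_map (@tens_assoc F U U U)
        (fps_map id_coproduct twist_val * fps_map (fun x => 1 ⊗ x) twist_val);
  twist_counitl : fps_map counit_id twist_val = 1;
  twist_counitr : fps_map id_counit twist_val = 1
}.

(* (a (x) b) (x (x) y) = (a x) (x) (b y). *)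
Definition act_op_op (h : tensor U U) (x : tensor D D) : tensor D D :=
  tens_lift (fun a b => tens_map (action_diff a) (action_diff b) x) h.

Definition act_op_fun (h : tensor U U) (x : tensor D M) : tensor D M :=
  tens_lift (fun a b => tens_map (action_diff a) (action_fun b) x) h.

Definition twisted_mul (Phi : twist) (A B : fps D) : fps D :=
  fps_map (tens_lift (fun A' B' : D => A' * B'))
    (fps_conv act_op_op Phi (fps_conv (@pure_tensor F D D) A B)).

Definition twisted_app (Phi : twist) (A : fps D) (f : fps M) : fps M :=
  fps_map (tens_lift (fun (A' : D) (f' : M) => A' f'))
    (fps_conv act_op_fun Phi (fps_conv (@pure_tensor F D M) A f)).

Definition fps_app (A : fps D) (f : fps M) : fps M :=
  fps_conv (fun (A' : D) (f' : M) => A' f') A f.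

Definition fps_scale (V : lmodType F) (c : fps F^o) (x : fps V) : fps V :=
  fps_conv *:%R c x.

(* P rho xi mu nu is the entry with upper indices rho, xi and lower indices
   mu, nu. *)
Definition is_matrix_on_partials (Psi : fps (tensor U U))
    (P : 'I_4 -> 'I_4 -> 'I_4 -> 'I_4 -> fps F^o) : Prop :=
  forall mu nu,
    fps_conv act_op_op Psi (fps_const (partial F mu ⊗ partial F nu)) =
    \sum_rho \sum_xi
       fps_scale (P rho xi mu nu) (fps_const (partial F rho ⊗ partial F xi)).

Lemma fps_conv_const_r (A : Type) (V W : zmodType) (b : A -> V -> W) x v n :
  (forall a, b a 0 = 0) -> fps_conv b x (fps_const v) n = b (x n) v.
Proof.
move=> b0; rewrite /fps_conv big_ord_recr /= subnn big1 ?add0r // => i _.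
by rewrite /fps_const subn_eq0 leqNgt ltn_ord /= b0.
Qed.

Let span (A : D) := exists c : 'I_4 -> F, A = \sum_rho c rho *: partial F rho.

Let span_lin c A B : span A -> span B -> span (c *: A + B).
Proof.
move=> [a ->] [b ->]; exists (fun rho => c * a rho + b rho).
rewrite scaler_sumr -big_split; apply: eq_bigr => rho _ /=.
by rewrite scalerDl scalerA.
Qed.
Let span_partial mu : span (partial F mu).
Proof.
exists (fun rho => (rho == mu)%:R); rewrite (bigD1 mu) //= eqxx scale1r.
by rewrite big1 ?addr0 // => rho /negbTE ->; rewrite scale0r.
Qed.
Let span0 : span 0.
Proof. by exists (fun=> 0); rewrite big1 // => rho _; rewrite scale0r. Qed.
Let spanZ c A : span A -> span (c *: A).
Proof. by move=> sA; rewrite -[_ *: _]addr0; apply: span_lin. Qed.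
Let spanD A B : span A -> span B -> span (A + B).
Proof. by move=> sA sB; rewrite -[A]scale1r; apply: span_lin. Qed.
Let span_sum (I : finType) (G : I -> D) :
  (forall i, span (G i)) -> span (\sum_i G i).
Proof. by move=> sG; apply: (big_ind span). Qed.

Let endo0 (V : algType F) (f : endo V) : f 0 = 0.
Proof. by have := endoP f (-1) 0 0; rewrite scaler0 addr0 scaleN1r addNr. Qed.
Let endoZ (V : algType F) (f : endo V) c x : f (c *: x) = c *: f x.
Proof. by have := endoP f c x 0; rewrite endo0 !addr0. Qed.
Let endo_sum (V : algType F) (f : endo V) (I : finType) (G : I -> V) :
  f (\sum_i G i) = \sum_i f (G i).
Proof.
apply: (big_morph f) => [x y|]; last exact: endo0.
by have := endoP f 1 x y; rewrite !scale1r.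
Qed.

Lemma vector_field_partial (X : 'M[F]_4) mu :
  vector_field X * partial F mu - partial F mu * vector_field X =
  \sum_rho X rho mu *: partial F rho.
Proof.
rewrite /vector_field mulNr mulrN opprK addrC mulr_sumr mulr_suml -sumrB.
apply: eq_bigr => rho _; rewrite mulr_sumr mulr_suml -sumrB.
rewrite (bigD1 mu) //= big1 ?addr0 => [|nu numu];
  rewrite -scalerAl -scalerAr -scalerBr mulrA partial_coord mulrDl.
  by rewrite eqxx mul1r -!mulrA [partial F mu * partial F rho]partialC addrK.
by rewrite eq_sym (negbTE numu) mul0r add0r -!mulrA [partial F mu * _]partialC subrr scaler0.
Qed.

Lemma action_diff_span u A : span A -> span (action_diff u A).
Proof.
rewrite /action_diff /env_lift; elim: (repr u) A => [X|c|t IHt t' IHt'|t IHt t' IHt'] A sA /=.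
- case: sA => a ->.
  change (span (action_diff_gen X (\sum_rho a rho *: partial F rho))).
  rewrite endo_sum; apply: span_sum => mu; rewrite endoZ; apply: spanZ.
  by rewrite /= vector_field_partial; apply: span_sum => rho; apply: spanZ.
- by apply: spanZ.
- by apply: spanD; [apply: IHt|apply: IHt'].
- by apply: IHt; apply: IHt'.
Qed.

Let tens_map_bilinear (a b : U) : bilinear_for *:%R *:%R
  (fun A B : D => action_diff a A ⊗ action_diff b B).
Proof.
have PB := pure_tensor_bilinear D D.
by split=> [B c A A'|A c B B'] /=; rewrite /action_diff endoP ?PB.1 ?PB.2.
Qed.

Lemma act_op_op0 h : act_op_op h 0 = 0.
Proof.
rewrite /act_op_op /tens_lift /tens_eval big1 // => p _.
exact: (tens_lift_zero (tens_map_bilinear _ _)).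
Qed.

Lemma act_op_op_partial (h : tensor U U) mu nu : exists c : 'I_4 -> 'I_4 -> F,
  act_op_op h (partial F mu ⊗ partial F nu) =
  \sum_rho \sum_xi c rho xi *: (partial F rho ⊗ partial F xi).
Proof.
have PB := pure_tensor_bilinear D D.
rewrite /act_op_op /tens_lift /tens_eval; elim: (repr h) => [|p s [c IH]].
  exists (fun _ _ => 0); rewrite big_nil big1 // => rho _.
  by rewrite big1 // => xi _; rewrite scale0r.
rewrite big_cons {}IH -/(tens_lift _ _) /tens_map.
rewrite (tens_lift_pure (tens_map_bilinear _ _)).
have [a ->] := action_diff_span p.1 (span_partial mu).
have [b ->] := action_diff_span p.2 (span_partial nu).
exists (fun rho xi => a rho * b xi + c rho xi).
have suml (f : 'I_4 -> D) (B : D) : (\sum_i f i) ⊗ B = \sum_i (f i ⊗ B).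
  apply: (big_morph (fun A : D => A ⊗ B)) => [x y|]; last exact: (bilin0l PB B).
  exact: (bilinDl PB x y B).
have sumr (A : D) (f : 'I_4 -> D) : A ⊗ (\sum_i f i) = \sum_i (A ⊗ f i).
  apply: (big_morph (pure_tensor A)) => [x y|]; last exact: (bilin0r PB A).
  exact: (bilinDr PB A x y).
rewrite suml.
rewrite -big_split; apply: eq_bigr => rho _ /=.
rewrite sumr.
rewrite -big_split; apply: eq_bigr => xi _ /=.
by rewrite (bilinZl PB) (bilinZr PB) scalerA scalerDl.
Qed.

Lemma matrix_on_partials_exists Psi : exists P, is_matrix_on_partials Psi P.
Proof.
have /choice[C CP] : forall q : nat * 'I_4 * 'I_4,
    exists c : 'I_4 -> 'I_4 -> F,
    act_op_op (Psi q.1.1) (partial F q.1.2 ⊗ partial F q.2) =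
    \sum_rho \sum_xi c rho xi *: (partial F rho ⊗ partial F xi).
  by move=> q; apply: act_op_op_partial.
exists (fun rho xi mu nu n => C (n, mu, nu) rho xi) => mu nu.
apply/funext => n; rewrite fps_conv_const_r; last exact: act_op_op0.
rewrite (CP (n, mu, nu)) fct_sumE; apply: eq_bigr => rho _.
rewrite fct_sumE; apply: eq_bigr => xi _.
by rewrite /fps_scale fps_conv_const_r // => c; rewrite scaler0.
Qed.

Definition matrix_on_partials Psi : 'I_4 -> 'I_4 -> 'I_4 -> 'I_4 -> fps F^o :=
  sval (cid (matrix_on_partials_exists Psi)).

Lemma matrix_on_partialsP Psi :
  is_matrix_on_partials Psi (matrix_on_partials Psi).
Proof. by rewrite /matrix_on_partials; case: cid. Qed.

Let partial_coef rho (A : D) : F^o := A (ps_var F rho) 0%MM.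

Lemma matrix_on_partials_unique Psi P :
  is_matrix_on_partials Psi P -> P = matrix_on_partials Psi.
Proof.
move=> HP; have HQ := matrix_on_partialsP Psi.
pose b rho xi (A B : D) := partial_coef rho A * partial_coef xi B.
have bP rho xi : bilinear_for *:%R *:%R (b rho xi).
  split=> [B c A A'|A c B B']; rewrite /b /partial_coef /=.
    change ((c * A (ps_var F rho) 0%MM + A' (ps_var F rho) 0%MM) * B (ps_var F xi) 0%MM = c * (A (ps_var F rho) 0%MM * B (ps_var F xi) 0%MM) + A' (ps_var F rho) 0%MM * B (ps_var F xi) 0%MM).
    by rewrite mulrDl mulrA.
  change (A (ps_var F rho) 0%MM * (c * B (ps_var F xi) 0%MM + B' (ps_var F xi) 0%MM) = c * (A (ps_var F rho) 0%MM * B (ps_var F xi) 0%MM) + A (ps_var F rho) 0%MM * B' (ps_var F xi) 0%MM).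
  by rewrite mulrDr mulrCA.
have pE rho mu : partial_coef rho (partial F mu) = (mu == rho)%:R.
  change (ps_deriv mu (ps_var F rho) 0%MM = (mu == rho)%:R).
  rewrite ps_deriv_var; case: (mu == rho); last by [].
  by change (ps_const (1 : F) (0%MM : 'X_{1..4}) = 1); rewrite /ps_const eqxx.
have key (Q : 'I_4 -> 'I_4 -> 'I_4 -> 'I_4 -> fps F^o) :
    is_matrix_on_partials Psi Q -> forall rho xi mu nu n, Q rho xi mu nu n =
    tens_lift (b rho xi)
      (fps_conv act_op_op Psi (fps_const (partial F mu ⊗ partial F nu)) n).
  move=> HQ' rho xi mu nu n; rewrite HQ' fct_sumE.
  have add := tens_lift_add (bP rho xi); have zer := tens_lift_zero (bP rho xi).
  rewrite (big_morph _ add zer) (bigD1 rho) //= [X in _ = _ + X]big1 ?addr0.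
    rewrite fct_sumE (big_morph _ add zer) (bigD1 xi) //= [X in _ = _ + X]big1 ?addr0.
      rewrite /fps_scale fps_conv_const_r => [|c]; last by rewrite scaler0.
      rewrite (tens_lift_scale (bP _ _)) (tens_lift_pure (bP _ _)) /b !pE !eqxx.
      by rewrite mulr1 /GRing.scale /= mulr1.
    move=> i /negbTE ni; rewrite /fps_scale fps_conv_const_r => [|c]; last by rewrite scaler0.
    rewrite (tens_lift_scale (bP _ _)) (tens_lift_pure (bP _ _)) /b !pE ni.
    by rewrite mulr0 scaler0.
  move=> i /negbTE ni; rewrite fct_sumE (big_morph _ add zer) big1 // => j _.
  rewrite /fps_scale fps_conv_const_r => [|c]; last by rewrite scaler0.
  rewrite (tens_lift_scale (bP _ _)) (tens_lift_pure (bP _ _)) /b !pE ni.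
  by rewrite mul0r scaler0.
apply/funext => rho; apply/funext => xi; apply/funext => mu; apply/funext => nu.
by apply/funext => n; rewrite (key _ HP) (key _ HQ).
Qed.

(* The matrix contracted against is that of Phi^-1, with both lower indices
   summed against g^{mu nu}. *)
Definition twisted_metric (Phi : twist) (rho xi : 'I_4) : fps F^o :=
  \sum_mu \sum_nu
    (metric F mu nu *: matrix_on_partials (twist_inv Phi) rho xi mu nu).

Definition dalembertian : D :=
  \sum_mu \sum_nu metric F mu nu *: (partial F mu * partial F nu).

Definition twisted_dalembertian (Phi : twist) : fps D :=
  \sum_mu \sum_nu fps_scale (twisted_metric Phi mu nu)
    (twisted_mul Phi (fps_const (partial F mu)) (fps_const (partial F nu))).

End TwistedOperations.

(* Main.v *)
(* Since U (x) U acts on pairs of differential operators, Phi undoes the Phi^-1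
   contained in the twisted metric, which leaves the classical d'Alembertian.  The
   relation X g + g X^T = 0 makes that operator Lorentz invariant, so Phi_1 acts on
   it, and on the mass term, through the counit; the counit axiom of the twist then
   identifies the twisted with the untwisted application to f. *)
Require Import Defs.
From HB Require Import structures.
From mathcomp Require Import all_boot all_order all_algebra.
From mathcomp Require Import boolp reals complex.

Set Implicit Arguments.
Unset Strict Implicit.
Unset Printing Implicit Defensive.

Import GRing.Theory.

Local Open Scope ring_scope.

(** * Linear maps and maps out of a tensor product *)

Section LinearMaps.
Variables (F : fieldType) (V W : lmodType F) (f : V -> W).
Hypothesis f_linear : linear f.

Lemma linear_fun0 : f 0 = 0.
Proof. by have := f_linear (-1) 0 0; rewrite !scaleN1r !addNr. Qed.

Lemma linear_funD x y : f (x + y) = f x + f y.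
Proof. by have := f_linear 1 x y; rewrite !scale1r. Qed.

Lemma linear_funZ c x : f (c *: x) = c *: f x.
Proof. by have := f_linear c x 0; rewrite linear_fun0 !addr0. Qed.

Lemma linear_fun_sum (I : Type) (r : seq I) (P : pred I) (G : I -> V) :
  f (\sum_(i <- r | P i) G i) = \sum_(i <- r | P i) f (G i).
Proof. exact: (big_morph f linear_funD linear_fun0). Qed.
End LinearMaps.

Section TensorLift.
Variables (F : fieldType) (A B W : lmodType F).

(** Both sides evaluate the same representative of [h], so only additivity of [g] over a finite sum
    is at work. *)
Lemma tens_lift_comp (W' : lmodType F) (g : W -> W') (b : A -> B -> W) h :
  linear g -> g (tens_lift b h) = tens_lift (fun x y => g (b x y)) h.
Proof. by move=> gL; rewrite /tens_lift /tens_eval linear_fun_sum. Qed.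

Lemma eq_tens_lift (b b' : A -> B -> W) :
  (forall x y, b x y = b' x y) -> tens_lift b =1 tens_lift b'.
Proof. by move=> bb' h; apply: eq_bigr => p _. Qed.

Lemma tens_lift_fun_linear (V : lmodType F) (b : A -> B -> V -> W) h :
  (forall x y, linear (b x y)) -> linear (fun v => tens_lift (fun x y => b x y v) h).
Proof.
move=> bL c v w; rewrite /tens_lift /tens_eval scaler_sumr -big_split.
by apply: eq_bigr => p _; apply: bL.
Qed.

Lemma tens_map_linear (A' B' : lmodType F) (f : A -> A') (g : B -> B') :
  linear f -> linear g -> linear (tens_map f g).
Proof.
move=> fL gL; apply: tens_lift_linear; have PB := pure_tensor_bilinear A' B'.
by split=> [y c x x'|x c y y'] /=; rewrite ?fL ?gL ?PB.1 ?PB.2.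
Qed.

Lemma tens_map_pure (A' B' : lmodType F) (f : A -> A') (g : B -> B') x y :
  linear f -> linear g -> tens_map f g (x ⊗ y) = f x ⊗ g y.
Proof.
move=> fL gL; rewrite /tens_map tens_lift_pure //.
have PB := pure_tensor_bilinear A' B'.
by split=> [y' c x' x''|x' c y' y''] /=; rewrite ?fL ?gL ?PB.1 ?PB.2.
Qed.

(** Pure tensors span; identities between actions are reduced to them, one tensor argument at a
    time. *)
Lemma tens_linear_eq (f g : tensor A B -> W) :
  linear f -> linear g -> (forall x y, f (x ⊗ y) = g (x ⊗ y)) -> f =1 g.
Proof.
move=> fL gL fg; elim/tens_ind => [|x y IH IH'|//].
  by rewrite !linear_fun0.
by rewrite !linear_funD // IH IH'.
Qed.
End TensorLift.

(** * Convolution of power series in the deformation parameter *)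

Section FpsConvolution.
Variable F : fieldType.

Lemma fps_const_linear (V : lmodType F) : linear (@fps_const V : V -> fps V).
Proof.
move=> c v w; apply/funext => -[//|n].
by change (0 = c *: 0 + 0 :> V); rewrite scaler0 addr0.
Qed.

Lemma fps_map_const (V W : lmodType F) (f : V -> W) v :
  f 0 = 0 -> fps_map f (fps_const v) = fps_const (f v).
Proof. by move=> f0; apply/funext => -[|n]. Qed.

Lemma fps_convC (A B : Type) (W : nmodType) (b : A -> B -> W) x y :
  fps_conv b x y = fps_conv (fun v u => b u v) y x.
Proof.
apply/funext => n; rewrite /fps_conv (reindex_inj rev_ord_inj) /=.
by apply: eq_bigr => i _; rewrite (sub_ordK i).
Qed.

Lemma fps_conv_constr (A : Type) (V W : zmodType) (b : A -> V -> W) x v :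
  (forall u, b u 0 = 0) -> fps_conv b x (fps_const v) = fps_map (b^~ v) x.
Proof. by move=> b0; apply/funext => n; rewrite fps_conv_const_r. Qed.

Lemma fps_conv_constl (A : Type) (V W : zmodType) (b : V -> A -> W) v x :
  (forall u, b 0 u = 0) -> fps_conv b (fps_const v) x = fps_map (b v) x.
Proof. by move=> b0; rewrite fps_convC fps_conv_constr. Qed.

Lemma fps_map_conv (A B : Type) (V W : lmodType F) (g : V -> W) (b : A -> B -> V)
    x y : linear g -> fps_map g (fps_conv b x y) = fps_conv (fun u v => g (b u v)) x y.
Proof. by move=> gL; apply/funext => n; rewrite /fps_map linear_fun_sum. Qed.

Lemma fps_map_linear (V W : lmodType F) (g : V -> W) :
  linear g -> linear (fps_map g : fps V -> fps W).
Proof. by move=> gL c x y; apply/funext => n; apply: gL. Qed.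

Lemma fps_conv_linearr (A : Type) (V W : lmodType F) (b : A -> V -> W) x :
  (forall u, linear (b u)) -> linear (fps_conv b x : fps V -> fps W).
Proof.
move=> bL c y z; apply/funext => n.
change (fps_conv b x (c *: y + z) n = c *: fps_conv b x y n + fps_conv b x z n).
rewrite /fps_conv scaler_sumr -big_split; apply: eq_bigr => i _; exact: bL.
Qed.

Lemma fps_conv_linearl (A : Type) (V W : lmodType F) (b : V -> A -> W) y :
  (forall u, linear (b^~ u)) -> linear (fun x : fps V => fps_conv b x y : fps W).
Proof.
move=> bL c x z; rewrite fps_convC (fps_conv_linearr _ bL).
by congr (_ *: _ + _); rewrite fps_convC.
Qed.

(** Each coefficient is a double sum over the degrees taken from [x] and [z], the degree of [y]
    being what remains of [n]. With four different pairings this gives the module law for an action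
    extended to series. *)
Lemma fps_convA (A B C : Type) (V V' W : lmodType F)
    (b1 : V -> C -> W) (b2 : A -> B -> V) (b3 : A -> V' -> W) (b4 : B -> C -> V')
    x y z :
  (forall w, linear (b1^~ w)) -> (forall u, linear (b3 u)) ->
  (forall u v w, b1 (b2 u v) w = b3 u (b4 v w)) ->
  fps_conv b1 (fps_conv b2 x y) z = fps_conv b3 x (fps_conv b4 y z).
Proof.
move=> b1L b3L b13; apply/funext => n; apply/esym.
pose coef j k := b3 (x j) (b4 (y (n - j - k)%N) (z k)).
transitivity (\sum_(j < n.+1) \sum_(k < n.+1 | (k <= n - j)%N) coef j k).
  apply: eq_bigr => /= j _; rewrite fps_convC /fps_conv (linear_fun_sum (b3L _)).
  by rewrite (big_ord_narrow_leq (leq_subr _ _)).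
(* The range [j + k <= n] is symmetric, so the two summations can be exchanged. *)
rewrite (exchange_big_dep predT) //= fps_convC; apply: eq_bigr => k _.
transitivity (\sum_(j < n.+1 | (j <= n - k)%N) coef j k).
  apply: eq_bigl => j; rewrite -ltnS -(ltnS j) -!subSn ?leq_ord //.
  by rewrite -subn_gt0 -(subn_gt0 j) -!subnDA addnC.
rewrite (big_ord_narrow_leq (leq_subr _ _)) [in RHS]/fps_conv (linear_fun_sum (b1L _)).
by apply: eq_bigr => j _; rewrite /coef b13 -!subnDA addnC.
Qed.

Lemma fps_scale_const (V : lmodType F) c (v : V) :
  fps_scale c (fps_const v) = fps_map (fun a => a *: v) c.
Proof. by rewrite /fps_scale fps_conv_constr // => a; rewrite scaler0. Qed.

Lemma fps_scale_linearl (V : lmodType F) (x : fps V) :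
  linear (fun c : fps F^o => fps_scale c x : fps V).
Proof. by apply: fps_conv_linearl => v a c d; rewrite scalerDl scalerA. Qed.

(** Scalar series pass through an action: linearity of [b u] moves each coefficient of [c] out, and
    the swap of convolution arguments aligns the degrees. *)
Lemma fps_conv_scale_const (A : Type) (V W : lmodType F) (b : A -> V -> W) x c v :
  (forall u, linear (b u)) ->
  fps_conv b x (fps_scale c (fps_const v)) =
  fps_scale c (fps_conv b x (fps_const v)).
Proof.
move=> bL; rewrite fps_scale_const fps_conv_constr => [|u]; last exact: linear_fun0.
rewrite fps_convC /fps_scale; apply/funext => n; apply: eq_bigr => i _.
by rewrite /fps_map (linear_funZ (bL _)).
Qed.

Lemma fps_map_scale (V W : lmodType F) (g : V -> W) c x :
  linear g -> fps_map g (fps_scale c x) = fps_scale c (fps_map g x).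
Proof.
move=> gL; rewrite fps_map_conv //; apply/funext => n; apply: eq_bigr => i _.
by rewrite (linear_funZ gL).
Qed.
End FpsConvolution.

(** * The actions of the enveloping algebra and of its tensor square *)

Section Actions.
Variable F : fieldType.
Local Notation M := (pseries F 4).
Local Notation D := (diffop F 4).
Local Notation U := (envalg (so13 F)).

Lemma action_diff_linearr (u : U) : linear (action_diff u).
Proof. exact: endoP. Qed.

Lemma action_diff_linearl A : linear (fun u : U => action_diff u A).
Proof. by move=> c u v; rewrite /action_diff linearP. Qed.

Lemma action_diff1 A : action_diff (1 : U) A = A.
Proof. by rewrite /action_diff rmorph1. Qed.

Lemma action_diffM (u v : U) A :
  action_diff (u * v) A = action_diff u (action_diff v A).
Proof. by rewrite /action_diff rmorphM. Qed.

Lemma action_fun_linearr (u : U) : linear (action_fun u).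
Proof. exact: endoP. Qed.

Lemma action_fun_linearl f : linear (fun u : U => action_fun u f).
Proof. by move=> c u v; rewrite /action_fun linearP. Qed.

Lemma action_fun1 f : action_fun (1 : U) f = f.
Proof. by rewrite /action_fun rmorph1. Qed.

Lemma diffop_linear (A : D) : linear (A : M -> M).
Proof. exact: endoP. Qed.

Lemma mul_diffop_bilinear :
  bilinear_for *:%R *:%R (fun A B : D => A * B).
Proof.
by split=> [B c A A'|A c B B'] /=;
  rewrite ?mulrDl ?mulrDr -?scalerAl -?scalerAr.
Qed.

Lemma app_diffop_bilinear :
  bilinear_for *:%R *:%R (fun (A : D) (f : M) => A f : M).
Proof. by split=> [f c A A'|A c f f'] //=; rewrite diffop_linear. Qed.

Lemma action_op_op_bilinear (x : tensor D D) : bilinear_for *:%R *:%R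
  (fun a b : U => tens_map (action_diff a) (action_diff b) x).
Proof.
have PB := pure_tensor_bilinear D D.
split=> [b c a a'|a c b b'] /=; rewrite /tens_map /tens_lift /tens_eval;
  rewrite scaler_sumr -big_split; apply: eq_bigr => p _ /=.
  by rewrite action_diff_linearl PB.1.
by rewrite action_diff_linearl PB.2.
Qed.

Lemma act_op_op_linearl x : linear (fun h : tensor U U => act_op_op h x).
Proof. exact/tens_lift_linear/action_op_op_bilinear. Qed.

Lemma act_op_op_linearr (h : tensor U U) : linear (act_op_op h).
Proof.
apply: tens_lift_fun_linear => a b.
by apply: tens_map_linear; apply: action_diff_linearr.
Qed.

Lemma act_op_op_pure (a b : U) (A B : D) :
  act_op_op (a ⊗ b) (A ⊗ B) = action_diff a A ⊗ action_diff b B.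
Proof.
rewrite /act_op_op (tens_lift_pure (action_op_op_bilinear _)) tens_map_pure //;
  exact: action_diff_linearr.
Qed.

Lemma act_op_op1 x : act_op_op (1 : tensor U U) x = x.
Proof.
move: x; apply: (tens_linear_eq (g := id)) => //; first exact: act_op_op_linearr.
by move=> A B; rewrite [1]/(1 ⊗ 1 : tensor U U) act_op_op_pure !action_diff1.
Qed.

Lemma act_op_opM (h k : tensor U U) x :
  act_op_op (h * k) x = act_op_op h (act_op_op k x).
Proof.
move: h; apply: tens_linear_eq => [c h h'|c h h'|a b].
- by rewrite mulrDl -scalerAl act_op_op_linearl.
- by rewrite act_op_op_linearl.
move: k; apply: tens_linear_eq => [c k k'|c k k'|a' b'].
- by rewrite mulrDr -scalerAr act_op_op_linearl.
- by rewrite act_op_op_linearl act_op_op_linearr.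
rewrite pure_tensorM.
move: x; apply: tens_linear_eq => [|c x x'|A B].
- exact: act_op_op_linearr.
- by rewrite !act_op_op_linearr.
by rewrite !act_op_op_pure !action_diffM.
Qed.

(** The two actions compose to that of [h * k], and the constant series 1 acts as the identity. With
    [h] the twist and [k] its inverse, this is the cancellation behind the twisted metric. *)
Lemma fps_act_op_opK (h k : fps (tensor U U)) x : h * k = 1 ->
  fps_conv (@act_op_op F) h (fps_conv (@act_op_op F) k x) = x.
Proof.
move=> hk; have -> : fps_conv (@act_op_op F) h (fps_conv (@act_op_op F) k x) =
    fps_conv (@act_op_op F) (h * k) x.
  apply/esym/fps_convA.
  - exact: act_op_op_linearl.
  - exact: act_op_op_linearr.
  - by move=> u v w; apply: act_op_opM.
rewrite hk; change (1 : fps (tensor U U)) with (fps_const (1 : tensor U U)).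
rewrite fps_conv_constl => [|u]; last exact: (linear_fun0 (act_op_op_linearl u)).
by apply/funext => n; apply: act_op_op1.
Qed.

(** * Lorentz invariance and the counit *)

Definition lorentz_invariant (A : D) :=
  forall X : so13 F, action_diff_gen X A = 0.

Lemma lorentz_invariantD A B :
  lorentz_invariant A -> lorentz_invariant B -> lorentz_invariant (A + B).
Proof. by move=> HA HB X; rewrite linear_funD ?HA ?HB ?addr0 //; apply: endoP. Qed.

(** Scalars commute with every vector field; this covers the mass term. *)
Lemma lorentz_invariant_scalar c : lorentz_invariant c%:A.
Proof. by move=> X; rewrite /= mulr_algl mulr_algr subrr. Qed.

(** Invariance is a condition on generators only. Induction on an expression representing [u]
    extends it: generators act by 0, which is their counit, constants act as themselves, and action
    and counit both respect sums and products. *)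
Lemma action_diff_invariant u A :
  lorentz_invariant A -> action_diff u A = (counit u : F) *: A.
Proof.
move=> HA; rewrite /action_diff /counit /env_lift.
pose ad := env_eval (action_diff_hom F); pose eps := env_eval (counit_hom (so13 F)).
elim: (repr u) => [X|c|t IHt t' IHt'|t IHt t' IHt'].
- by rewrite [RHS]scale0r; apply: HA.
- by change (c *: A = (c * 1) *: A); rewrite mulr1.
- change (ad t A + ad t' A = (eps t + eps t' : F) *: A).
  by rewrite [ad t A]IHt [ad t' A]IHt' scalerDl.
- change (ad t (ad t' A) = (eps t * eps t' : F) *: A).
  by rewrite [ad t' A]IHt' (linear_funZ (endoP _)) [ad t A]IHt scalerA mulrC.
Qed.

Lemma metricK : metric F *m metric F = 1%:M.
Proof.
apply/matrixP => i j; rewrite !mxE (bigD1 i) //= big1 ?addr0 => [|k /negbTE ki].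
  rewrite !mxE eqxx; have [_|_] := eqVneq i j; last by rewrite mulr0.
  by case: ifP; rewrite ?mulrNN mulr1.
by rewrite !mxE eq_sym ki mul0r.
Qed.

(** Membership in [so13] preserves the metric with lower indices; the d'Alembertian contracts with
    upper ones. Multiplying by the metric, its own inverse, on both sides passes from one form to
    the other. *)
Lemma so13_metric (X : so13 F) :
  (X : 'M[F]_4) *m metric F + metric F *m (X : 'M[F]_4)^T = 0.
Proof.
have := so13P X => /(congr1 (fun Y => metric F *m Y *m metric F)).
rewrite mulmxN mulNmx !mulmxA metricK mul1mx -!mulmxA metricK mulmx1.
by move=> ->; rewrite subrr.
Qed.

(** The commutator with a vector field rotates each derivative in turn; collecting terms, the
    coefficient of [d mu nu] is an entry of the matrix that [so13_metric] shows to vanish. *)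
Lemma dalembertian_invariant : lorentz_invariant (dalembertian F).
Proof.
move=> X; rewrite /dalembertian.
have L := endoP (action_diff_gen X).
pose d mu nu : D := partial F mu * partial F nu.
have dE mu nu : action_diff_gen X (d mu nu) =
    \sum_rho X rho mu *: d rho nu + \sum_rho X rho nu *: d mu rho.
  (* Leibniz rule for the commutator. *)
  have -> : action_diff_gen X (d mu nu) =
      (vector_field X * partial F mu - partial F mu * vector_field X) * partial F nu
      + partial F mu *
        (vector_field X * partial F nu - partial F nu * vector_field X).
    by rewrite /= /d mulrBl mulrBr !mulrA addrA subrK.
  rewrite !vector_field_partial mulr_suml mulr_sumr; congr (_ + _);
    by apply: eq_bigr => rho _; rewrite -?scalerAl -?scalerAr.
transitivity (\sum_mu \sum_nu
   (((X : 'M[F]_4) *m metric F) mu nu + (metric F *m (X : 'M[F]_4)^T) mu nu) *: d mu nu).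
  transitivity (\sum_mu \sum_nu (\sum_rho (metric F mu nu * X rho mu) *: d rho nu +
                                 \sum_rho (metric F mu nu * X rho nu) *: d mu rho)).
    rewrite (linear_fun_sum L); apply: eq_bigr => mu _.
    rewrite (linear_fun_sum L); apply: eq_bigr => nu _.
    rewrite (linear_funZ L) dE scalerDr !scaler_sumr.
    by congr (_ + _); apply: eq_bigr => rho _; rewrite scalerA.
  under eq_bigr do rewrite big_split /=.
  under [RHS]eq_bigr do under eq_bigr do rewrite scalerDl.
  under [RHS]eq_bigr do rewrite big_split /=.
  rewrite !big_split /=; congr (_ + _).
    (* Reordering makes the index contracted with the metric innermost, which exhibits a matrix
       product entry. *)
    under eq_bigr do rewrite exchange_big /=.
    rewrite exchange_big /=; apply: eq_bigr => rho _; rewrite exchange_big /=.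
    apply: eq_bigr => nu _; rewrite mxE scaler_suml.
    by apply: eq_bigr => mu _; rewrite mulrC.
  apply: eq_bigr => mu _; rewrite exchange_big /=; apply: eq_bigr => rho _.
  by rewrite mxE scaler_suml; apply: eq_bigr => nu _; rewrite !mxE.
apply: big1 => mu _; apply: big1 => nu _.
have := congr1 (fun Y : 'M[F]_4 => Y mu nu) (so13_metric X).
by rewrite [in X in X -> _]mxE [in X in _ = X -> _]mxE => ->; rewrite scale0r.
Qed.
End Actions.

(** * Cancellation of the twist in the operator and in its application *)

Section Twist.
Variables (F : fieldType) (Phi : twist F).
Local Notation M := (pseries F 4).
Local Notation D := (diffop F 4).
Local Notation U := (envalg (so13 F)).

Lemma twisted_mul_const (A B : D) :
  twisted_mul Phi (fps_const A) (fps_const B) =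
  fps_map (tens_lift (fun A' B' : D => A' * B'))
    (fps_conv (@act_op_op F) Phi (fps_const (A ⊗ B))).
Proof.
have PB := pure_tensor_bilinear D D.
rewrite /twisted_mul fps_conv_constl => [|u]; last exact: (bilin0l PB).
by rewrite fps_map_const //; exact: (bilin0r PB).
Qed.

Lemma twisted_dalembertianE :
  twisted_dalembertian Phi = fps_const (dalembertian F).
Proof.
pose mul : tensor D D -> D := tens_lift (fun A' B' : D => A' * B').
have mulL : linear mul := tens_lift_linear (@mul_diffop_bilinear F).
pose act := fps_conv (@act_op_op F).
have actL h : linear (act h : fps _ -> fps _).
  exact: (fps_conv_linearr h (@act_op_op_linearr F)).
pose t mu nu : fps (tensor D D) := fps_const (partial F mu ⊗ partial F nu).
pose T : fps (tensor D D) := \sum_mu \sum_nu metric F mu nu *: t mu nu.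
(* Before multiplication, contracting with the twisted metric amounts to letting the inverse twist
   act on the classical contraction [T]. *)
have TE : \sum_rho \sum_xi fps_scale (twisted_metric Phi rho xi) (t rho xi) =
          act (twist_inv Phi) T.
  transitivity (\sum_rho \sum_xi \sum_mu \sum_nu metric F mu nu *:
      fps_scale (matrix_on_partials (twist_inv Phi) rho xi mu nu) (t rho xi)).
    apply: eq_bigr => rho _; apply: eq_bigr => xi _.
    have L := fps_scale_linearl (t rho xi).
    rewrite /twisted_metric (linear_fun_sum L); apply: eq_bigr => mu _.
    rewrite (linear_fun_sum L); apply: eq_bigr => nu _.
    exact: (linear_funZ L).
  rewrite /T (linear_fun_sum (actL _)).
  (* The sums over [mu] and [nu] move outside, leaving the sum over [rho] and [xi] that defines the
     matrix of the inverse twist. *)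
  under eq_bigr do rewrite exchange_big /=.
  rewrite exchange_big /=; apply: eq_bigr => mu _.
  rewrite (linear_fun_sum (actL _)).
  under eq_bigr do rewrite exchange_big /=.
  rewrite exchange_big /=; apply: eq_bigr => nu _.
  rewrite (linear_funZ (actL _)) /act matrix_on_partialsP scaler_sumr.
  by apply: eq_bigr => rho _; rewrite scaler_sumr.
(* The twisted product is the ordinary product after acting with [Phi]; both are linear and so come
   out of the contraction. *)
transitivity (fps_map mul (act Phi (act (twist_inv Phi) T))).
  have mapL := fps_map_linear mulL.
  rewrite -TE (linear_fun_sum (actL _)) (linear_fun_sum mapL).
  apply: eq_bigr => mu _; rewrite (linear_fun_sum (actL _)) (linear_fun_sum mapL).
  apply: eq_bigr => nu _.
  rewrite twisted_mul_const -fps_map_scale // /act fps_conv_scale_const //.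
  exact: act_op_op_linearr.
rewrite /act fps_act_op_opK; last exact: twist_mulrV.
have mapL := fps_map_linear mulL.
have constL := @fps_const_linear F D.
rewrite /T /dalembertian (linear_fun_sum mapL) (linear_fun_sum constL).
apply: eq_bigr => mu _; rewrite (linear_fun_sum mapL) (linear_fun_sum constL).
apply: eq_bigr => nu _; rewrite (linear_funZ mapL) (linear_funZ constL).
rewrite fps_map_const ?linear_fun0 // /mul tens_lift_pure //.
exact: mul_diffop_bilinear.
Qed.

(** The first leg of the twist acts on [A] by its counit, so only [counit_id] of the twist reaches
    [f], and that series is 1. *)
Lemma twisted_app_invariant (A : D) (f : fps M) : lorentz_invariant A ->
  twisted_app Phi (fps_const A) f = fps_app (fps_const A) f.
Proof.
move=> HA; have PB := pure_tensor_bilinear D M.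
have AB := @app_diffop_bilinear F.
pose app : tensor D M -> M := tens_lift (fun (A' : D) (f' : M) => A' f').
have appL : linear app := tens_lift_linear AB.
have step (h : tensor U U) (g : M) :
    app (act_op_fun h (A ⊗ g)) = A (action_fun (counit_id h) g).
  (* Both sides become lifts over the same [h], to be compared on a single pair [a], [b]. *)
  rewrite /act_op_fun (tens_lift_comp _ _ appL) /counit_id.
  rewrite (tens_lift_comp _ _ (action_fun_linearl g)).
  rewrite (tens_lift_comp _ _ (diffop_linear A)).
  apply: eq_tens_lift => a b.
  rewrite tens_map_pure; [|exact: action_diff_linearr|exact: action_fun_linearr].
  rewrite /app (tens_lift_pure AB) action_diff_invariant //.
  by rewrite (linear_funZ (action_fun_linearl g)) (linear_funZ (diffop_linear A)).
rewrite /twisted_app /fps_app.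
rewrite !fps_conv_constl => [|g|g]; [|exact: (bilin0l AB)|exact: (bilin0l PB)].
rewrite fps_map_conv //.
transitivity (fps_conv (fun u g => A (action_fun u g)) (fps_map (@counit_id F) Phi) f).
  by apply/funext => n; apply: eq_bigr => i _; apply: step.
rewrite twist_counitl; change (1 : fps U) with (fps_const (1 : U)).
rewrite fps_conv_constl => [|g].
  by apply/funext => n; rewrite /fps_map action_fun1.
by rewrite (linear_fun0 (action_fun_linearl g)) (linear_fun0 (diffop_linear A)).
Qed.
End Twist.

Theorem mainTheorem7 (R : realType) (Phi : twist R[i]) :
  twisted_dalembertian Phi = fps_const (dalembertian R[i])
  /\ forall (m : R[i]) (f : fps (pseries R[i] 4)),
       fps_app (fps_const (dalembertian R[i] + (m ^+ 2)%:A)) f = 0 ->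
       twisted_app Phi (twisted_dalembertian Phi + fps_const (m ^+ 2)%:A) f = 0.
Proof.
split=> [|m f KG]; first exact: twisted_dalembertianE.
(* The operator and the mass term merge into one constant series; once its invariance is known, the
   goal is the classical equation [KG]. *)
rewrite twisted_dalembertianE -(linear_funD (@fps_const_linear _ _)) twisted_app_invariant //.
apply: lorentz_invariantD; first exact: dalembertian_invariant.
exact: lorentz_invariant_scalar.
Qed.
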